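(* Let $F(z,w)=\sum_{k=0}^\infty P_k(z)w^k$ be a formal power series in $w$ with coefficients $P_k\in\mathbb C[z]$. Then $F\in\overline{\mathcal H}_2(\mathbb C)$ if and only if $\sum_{k=0}^n(n)_kP_k(z)w^k\in\mathcal H_2(\mathbb C)\cup\{0\}$ for all $n\in\mathbb N$.
   Context: $\mathcal H_2(\mathbb C)$ is the set of non-zero polynomials in $z,w$ that do not vanish when $\Im z>0$ and $\Im w>0$. $\overline{\mathcal H}_2(\mathbb C)$ is the set of entire functions of two variables that are limits, uniformly on compact subsets of $\mathbb C^2$, of polynomials in $\mathcal H_2(\mathbb C)$; $F\in\overline{\mathcal H}_2(\mathbb C)$ means the series defines such an entire function. $(n)_k=n(n-1)\cdots(n-k+1)$ for $k\le n$ and $(n)_k=0$ for $k>n$. *)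

(* Defs.v *)
From Stdlib Require Import Reals.
From Coquelicot Require Import Coquelicot.
Open Scope R_scope.

(* falling factorial (n)_k = n(n-1)...(n-k+1); equals 0 when k > n *)
Fixpoint falling (n k : nat) : nat :=
  match k with
  | O => 1%nat
  | S k' => (falling n k' * (n - k'))%nat
  end.

Definition poly2_bounded (N : nat) (c : nat -> nat -> C) : Prop :=
  forall i j : nat, (N < i)%nat \/ (N < j)%nat -> c i j = 0%C.

Definition poly2_eval (N : nat) (c : nat -> nat -> C) (z w : C) : C :=
  sum_n (fun i => sum_n (fun j => (c i j * (Cpow z i * Cpow w j))%C) N) N.

Definition in_H2 (g : C -> C -> C) : Prop :=
  exists (N : nat) (c : nat -> nat -> C),
    poly2_bounded N c /\
    (exists i j : nat, c i j <> 0%C) /\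
    (forall z w, g z w = poly2_eval N c z w) /\
    (forall z w, 0 < Im z -> 0 < Im w -> g z w <> 0%C).

Definition poly1_eval (d : nat) (p : nat -> C) (z : C) : C :=
  sum_n (fun i => (p i * Cpow z i)%C) d.

(* Uniform convergence on compact subsets of C^2, via the exhaustion of C^2
   by the closed polydiscs {|z| <= r, |w| <= r}. *)
Definition cvg_compact (Q : nat -> C -> C -> C) (f : C -> C -> C) : Prop :=
  forall r eps : R, 0 < r -> 0 < eps ->
    exists M : nat, forall m : nat, (M <= m)%nat ->
      forall z w : C, Cmod z <= r -> Cmod w <= r ->
        Cmod (Q m z w - f z w)%C < eps.

Definition in_H2bar_series (d : nat -> nat) (P : nat -> nat -> C) : Prop :=
  exists f : C -> C -> C,
    (forall z w : C,
       is_series (fun k => (poly1_eval (d k) (P k) z * Cpow w k)%C) (f z w)) /\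
    (exists Q : nat -> C -> C -> C, (forall m, in_H2 (Q m)) /\ cvg_compact Q f).

Definition trunc_poly (d : nat -> nat) (P : nat -> nat -> C) (n : nat) (z w : C) : C :=
  sum_n (fun k => (RtoC (INR (falling n k)) * poly1_eval (d k) (P k) z * Cpow w k)%C) n.

(* Main.v *)
Require Import Defs.
From Stdlib Require Import Reals List Lra Lia Classical Wf_nat IndefiniteDescription.
From Coquelicot Require Import Coquelicot.
From mathcomp Require all_boot all_order all_algebra complex Rstruct.

(** If [q] has no zeros in the upper half-plane, [sum (n)_k q_k w^k] is the
    reversal of [q(D) x^n]; factoring [q(D)] and applying Gauss-Lucas to each
    factor shows that it has no zeros there either, or vanishes identically.
    A polynomial [q] without zeros in the upper half-plane also satisfies
    [|q(x + iy')| <= |q(x + iy)|] for [|y'| <= y], and this property survives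
    limits.  It replaces Hurwitz' theorem: a zero of a limit propagates down a
    vertical segment, which forces a polynomial to vanish.

    Conversely, after the substitution [w -> w/n] the polynomials
    [sum (n)_k P_k w^k] have convergent coefficients.  By the monotonicity, a
    bound far up in the product of half-planes bounds them on a polydisc; such a
    bound is Szasz' inequality in [w], whose constants only involve the first
    nonzero [P_k] and the two coefficients after it.  Cauchy's estimate then yields convergence. *)

Definition lin_prod (w : C) (l : list C) : C :=
  fold_right (fun x acc => ((w - x) * acc)%C) 1%C l.
(** The factored form of a polynomial with constant term $1$: [l] lists the negated reciprocals of
    its roots, and [esym1], [esym2] give its coefficients of $w$ and $w^2$. *)
Definition one_prod (w : C) (l : list C) : C :=
  fold_right (fun b acc => ((1 + b * w) * acc)%C) 1%C l.
Definition esym1 (l : list C) : C := fold_right Cplus 0%C l.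
Fixpoint esym2 (l : list C) : C :=
  match l with nil => 0%C | b :: l' => (esym2 l' + b * esym1 l')%C end.

Local Notation C0 := (RtoC 0).
Local Notation C1 := (RtoC 1).
Local Notation CIm := Coquelicot.Complex.Im.

(** * Factorization into linear factors and differential operators with stable symbol *)

Module Roots.
Import all_boot all_order all_algebra complex Rstruct.
Import Order.TTheory GRing.Theory Num.Theory.
Local Open Scope ring_scope.
Delimit Scope C_scope with C.

Local Notation Ri := (complex.complex Rdefinitions.R).

(** [cc] and [uc] identify two models of the complex numbers; the target of [cc] is the one known to
    be algebraically closed. *)
Definition cc (z : C) : Ri := complex.Complex (fst z) (snd z).
Definition uc (z : Ri) : C := (complex.Re z, complex.Im z).

Lemma ccK z : uc (cc z) = z. Proof. by case: z. Qed.
Lemma ucK z : cc (uc z) = z. Proof. by case: z. Qed.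
Lemma cc_inj z w : cc z = cc w -> z = w.
Proof. by move=> h; rewrite -(ccK z) h ccK. Qed.
Lemma ccD z w : cc (z + w)%C = cc z + cc w. Proof. by []. Qed.
Lemma ccB z w : cc (z - w)%C = cc z - cc w. Proof. by []. Qed.
Lemma ccM z w : cc (z * w)%C = cc z * cc w. Proof. by []. Qed.
Lemma ccX z k : cc (Cpow z k) = cc z ^+ k.
Proof. by elim: k => [|k IH] //; rewrite exprS -IH -ccM. Qed.
Lemma cc_nat n : cc (RtoC (INR n)) = n%:R.
Proof.
elim: n => [|n IH] //.
by rewrite S_INR RtoC_plus ccD IH -[n.+1]addn1 natrD.
Qed.
Lemma cc_sum f N : cc (sum_n f N) = \sum_(i < N.+1) cc (f i).
Proof.
elim: N => [|N IH]; first by rewrite sum_O big_ord1.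
by rewrite sum_Sn ccD IH [RHS]big_ord_recr.
Qed.
Lemma cc_neq0 z : z <> C0 -> cc z != 0.
Proof. by move=> h; apply/eqP => /(@cc_inj z C0). Qed.

(** Neither degree nor coefficients are recorded, so closure under sums and products needs no
    bookkeeping. *)
Definition is_poly (g : C -> C) : Prop :=
  exists p : {poly Ri}, forall w, cc (g w) = p.[cc w].

Lemma is_poly_ext f g : (forall w, f w = g w) -> is_poly f -> is_poly g.
Proof. by move=> e [p hp]; exists p => w; rewrite -e hp. Qed.
Lemma is_poly_const a : is_poly (fun _ => a).
Proof. by exists (cc a)%:P => w; rewrite hornerC. Qed.
Lemma is_poly_id : is_poly (fun w => w).
Proof. by exists 'X => w; rewrite hornerX. Qed.
Lemma is_poly_plus f g : is_poly f -> is_poly g -> is_poly (fun w => f w + g w)%C.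
Proof. by move=> [p hp] [q hq]; exists (p + q) => w; rewrite hornerD ccD hp hq. Qed.
Lemma is_poly_mult f g : is_poly f -> is_poly g -> is_poly (fun w => f w * g w)%C.
Proof. by move=> [p hp] [q hq]; exists (p * q) => w; rewrite hornerM ccM hp hq. Qed.

Lemma cc_lin_prod w l :
  cc (lin_prod w l) = (\prod_(z <- map cc l) ('X - z%:P)).[cc w].
Proof.
elim: l => [|x l IH] /=; first by rewrite big_nil hornerC.
by rewrite big_cons hornerM ccM ccB IH hornerXsubC.
Qed.

Lemma is_poly_factor g : is_poly g ->
  (forall w, g w = C0) \/
  exists a l, a <> C0 /\ forall w, g w = (a * lin_prod w l)%C.
Proof.
move=> [p hp]; have [p0|pn0] := eqVneq p 0.
  by left=> w; apply: cc_inj; rewrite hp p0 horner0.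
right; have [r er] := closed_field_poly_normal p.
exists (uc (lead_coef p)), (map uc r); split.
  by move=> /(congr1 cc); rewrite ucK => /eqP; rewrite lead_coef_eq0 (negbTE pn0).
move=> w; apply: cc_inj; rewrite hp ccM ucK cc_lin_prod -map_comp.
by rewrite {1}er hornerZ (eq_map (g := id)) ?map_id // => z; exact: ucK.
Qed.

Lemma Im_inv (x : Ri) : complex.Im x < 0 -> 0 < complex.Im x^-1.
Proof.
case: x => a b /= hb; rewrite -mulNr; apply: divr_gt0; first by rewrite oppr_gt0.
by apply: ltr_wpDl; rewrite ?sqr_ge0 // exprn_even_gt0 //= lt_eqF.
Qed.

Lemma ImD (x y : Ri) : complex.Im (x + y) = complex.Im x + complex.Im y.
Proof. by case: x; case: y. Qed.
Lemma ImN (x : Ri) : complex.Im (- x) = - complex.Im x.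
Proof. by case: x. Qed.

(** The witness is the logarithmic derivative $t=\sum_z 1/(x-z)$. Each $x-z$ lies in the open lower
    half-plane, so each reciprocal lies in the open upper one. *)
Lemma deriv_prod_lower (s : seq Ri) (x : Ri) :
  complex.Im x < 0 -> all (fun z => 0 <= complex.Im z) s ->
  let p := \prod_(z <- s) ('X - z%:P) in
  exists t, [/\ p^`().[x] = p.[x] * t, p.[x] != 0, 0 <= complex.Im t &
             s != [::] -> 0 < complex.Im t].
Proof.
move=> hx; elim: s => [|z s IH] /=.
  by exists 0; rewrite big_nil derivC horner0 mulr0 hornerC oner_neq0.
case/andP=> hz /IH[t [et pn0 t0 _]].
have hxz : complex.Im (x - z) < 0.
  by rewrite ImD ImN subr_lt0; apply: lt_le_trans hz.
have xz0 : x - z != 0 by apply: contraTneq hxz => ->; rewrite ltxx.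
have tp : 0 < complex.Im (t + (x - z)^-1) by rewrite ImD ltr_wpDl // Im_inv.
exists (t + (x - z)^-1); rewrite big_cons; split=> //; last exact: ltW.
  rewrite derivM derivXsubC hornerD !hornerM hornerC hornerXsubC et mul1r mulrDr.
  by rewrite addrC mulrA; congr (_ + _); rewrite mulrAC divff // mul1r.
by rewrite hornerM hornerXsubC mulf_neq0.
Qed.

Definition lower_stable (p : {poly Ri}) :=
  p = 0 \/ forall x, complex.Im x < 0 -> p.[x] != 0.

(* Gauss-Lucas: p'/p maps the lower half-plane to the upper one. *)
Lemma lower_stable_deriv (p : {poly Ri}) (a : Ri) : complex.Im a <= 0 ->
  lower_stable p -> lower_stable (p^`() - a *: p).
Proof.
move=> ha [->|hp]; first by left; rewrite raddf0 scaler0 subrr.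
have [r er] := closed_field_poly_normal p.
have p0 : lead_coef p != 0.
  have := hp (- (complex.Complex 0 1)); rewrite lead_coef_eq0 /= => h; apply: contraTneq (h _) => [->|].
    by rewrite horner0 eqxx.
  by rewrite oppr_lt0 ltr01.
have hr : all (fun z => 0 <= complex.Im z) r.
  apply/allP => z zr; rewrite leNgt; apply/negP => /hp.
  by rewrite er hornerZ mulf_eq0 (negbTE p0) -[_ == 0]/(root _ _) root_prod_XsubC zr.
move: p0; set k := lead_coef p => p0.
have dE : p^`() - a *: p = k *: ((\prod_(z <- r) ('X - z%:P))^`()
             - a *: \prod_(z <- r) ('X - z%:P)).
  by rewrite er -/k derivZ scalerBr !scalerA mulrC.
(* Up to the factor $k$, the value at $x$ is $t-a$ times a nonzero number. If $p$ has roots, $\Im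
   t>0\ge\Im a$; if $p$ is constant, $t=0$, and only $a=0$ gives the zero polynomial. *)
have [a0|a0] := eqVneq a 0; have [r0|r0] := eqVneq r [::].
- by left; rewrite dE a0 r0 big_nil derivC scale0r subr0 scaler0.
all: right=> x hx; rewrite dE hornerZ mulf_neq0 //.
all: have [t [et pn0 t0 tp]] := deriv_prod_lower _ _ hx hr.
all: rewrite hornerD hornerN hornerZ et mulrC -mulrBl mulf_neq0 // subr_eq0.
- by rewrite a0; apply: contraTneq (tp r0) => ->; rewrite ltxx.
- by move: et; rewrite r0 big_nil derivC horner0 hornerC mul1r => <-; rewrite eq_sym.
- by apply: contraTneq (tp r0) => ->; rewrite -leNgt.
Qed.

(** Composing the operators $D-a$ corresponds to multiplying the polynomials $X-a$, so the fold
    evaluates their product at $D=d/dx$; [M] only has to exceed the degree. *)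
Lemma diff_op_prod (s : seq Ri) (p : {poly Ri}) M : (size s < M)%N ->
  foldr (fun a q => q^`() - a *: q) p s
  = \sum_(k < M) (\prod_(z <- s) ('X - z%:P))`_k *: p^`(k).
Proof.
elim: s M => [|a s IH] [|M] //=.
  move=> _; rewrite big_nil big_ord_recl big1 ?addr0 ?coef1 ?scale1r //.
  by move=> i _; rewrite coef1 /= scale0r.
rewrite ltnS => hM; rewrite big_cons.
under eq_bigr do rewrite mulrBl coefB coefXM coefCM scalerBl -scalerA.
rewrite sumrB -scaler_sumr -(IH M.+1) ?(leqW hM) //; congr (_ - _).
rewrite big_ord_recl /= scale0r add0r (IH M) //.
by rewrite raddf_sum; apply: eq_bigr => i _; rewrite /= derivZ -derivnS.
Qed.

Lemma falling_ffact n k : Defs.falling n k = n ^_ k.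
Proof. by elim: k => [|k IH] //=; rewrite IH ffactnSr. Qed.

Lemma cc_horner (c : nat -> C) N w :
  cc (sum_n (fun k => c k * Cpow w k)%C N) = (\poly_(i < N.+1) cc (c i)).[cc w].
Proof.
rewrite cc_sum horner_poly; apply: eq_bigr => i _.
by rewrite ccM ccX.
Qed.

Lemma upper_roots (c : nat -> C) N :
  (forall w, Rlt R0 (CIm w) -> sum_n (fun k => c k * Cpow w k)%C N <> C0) ->
  exists r : seq Ri, exists a : Ri, [/\ a != 0,
    \poly_(i < N.+1) cc (c i) = a *: \prod_(z <- r) ('X - z%:P) &
    all (fun z => complex.Im z <= 0) r].
Proof.
move=> hc; set P := \poly_(i < _) _.
have hP (x : Ri) : 0 < complex.Im x -> P.[x] != 0.
  by move=> hx; rewrite -(ucK x) -cc_horner; apply/cc_neq0/hc/RltP.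
have [r er] := closed_field_poly_normal P.
have p0 : lead_coef P != 0.
  have := hP (complex.Complex 0 1); rewrite lead_coef_eq0 /= => h; apply: contraTneq (h _) => [->|].
    by rewrite horner0 eqxx.
  exact: ltr01.
exists r, (lead_coef P); split=> //; apply/allP => z zr; rewrite leNgt.
apply/negP => /hP.
by rewrite er hornerZ mulf_eq0 (negbTE p0) -[_ == 0]/(root _ _) root_prod_XsubC zr.
Qed.

(* With q = sum c_k w^k, the sum below is w^n (q(D) x^n) evaluated at x = 1/w. *)
Lemma falling_stable (c : nat -> C) N n :
  (forall w, Rlt R0 (CIm w) -> sum_n (fun k => c k * Cpow w k)%C N <> C0) ->
  let h w := sum_n (fun k => RtoC (INR (Defs.falling n k)) * c k * Cpow w k)%C N in
  (forall w, Rlt R0 (CIm w) -> h w <> C0) \/ (forall w, Rlt R0 (CIm w) -> h w = C0).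
Proof.
move=> /upper_roots[r [a [a0 eP hr]]] h.
set q := foldr (fun a q => q^`() - a *: q) 'X^n r.
(* The only possible zero of $x^n$ is the origin, and every root $z$ has $\Im z\le0$, so each factor
   $D-z$ preserves lower stability. *)
have hq : lower_stable q.
  rewrite /q; elim: r hr {eP q} => [|z r IH] /=.
    move=> _; right=> x hx; rewrite hornerXn expf_neq0 //.
    by apply: contraTneq hx => ->; rewrite ltxx.
  by case/andP=> hz /IH; exact: lower_stable_deriv.
have eq1 : a *: q = \sum_(k < N.+1) cc (c k) *: 'X^n^`(k).
  have sr : (size r < N.+1)%N.
    have := size_poly N.+1 (cc \o c); rewrite eP size_scale // size_prod_XsubC.
    by [].
  rewrite /q (diff_op_prod _ _ _ sr) scaler_sumr; apply: eq_bigr => i _.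
  by rewrite scalerA -coefZ -eP coef_poly ltn_ord.
have E w : Rlt R0 (CIm w) -> cc (h w) = cc w ^+ n * (a * q.[(cc w)^-1]).
  move=> hw; have w0 : cc w != 0.
    by apply: cc_neq0 => e; move: hw; rewrite e; exact: Rlt_irrefl.
  rewrite -hornerZ eq1 horner_sum mulr_sumr /h cc_sum; apply: eq_bigr => k _.
  rewrite !ccM cc_nat ccX hornerZ derivnXn hornerMn hornerXn falling_ffact.
  (* For $k\le n$, $D^kx^n=(n)_kx^{n-k}$ at $x=1/w$, times $w^n$, is $(n)_kw^k$; for $k>n$ both
     sides vanish. *)
  have [kn|kn] := leqP k n; last by rewrite ffact_small // mulr0n mulr0 mulr0 !mul0r.
  have -> : cc w ^+ k = cc w ^+ n * (cc w)^-1 ^+ (n - k).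
    by rewrite -{1}(subnK kn) addnC exprD -mulrA -exprMn divff // expr1n mulr1.
  rewrite -(mulr_natl (_ ^+ (n - k))) -mulrA [RHS]mulrCA.
  by rewrite [X in _ = _ * X]mulrCA [RHS]mulrCA.
case: hq => hq.
  by right=> w /E e; apply: cc_inj; rewrite e hq horner0 !mulr0.
(* Inversion sends $w$ to the lower half-plane, where [q] has no zeros. *)
left=> w hw e; have := E w hw; rewrite e => /esym/eqP; apply/negP.
have w0 : cc w != 0.
  by apply: cc_neq0 => e'; move: hw; rewrite e'; exact: Rlt_irrefl.
rewrite !mulf_neq0 ?expf_neq0 //; apply: hq.
case: w hw {e w0} => x y /= /RltP hw.
rewrite oppr_lt0; apply: divr_gt0 => //.
by apply: ltr_wpDl; rewrite ?sqr_ge0 // exprn_gt0.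
Qed.

Lemma cc_one_prod w l :
  cc (one_prod w l) = (\prod_(z <- map cc l) (1 + z *: 'X)).[cc w].
Proof.
elim: l => [|x l IH] /=; first by rewrite big_nil hornerC.
by rewrite big_cons hornerM ccM ccD ccM IH hornerD hornerZ hornerX hornerC.
Qed.

Lemma coef_one_prod l (p := \prod_(z <- map cc l) (1 + z *: 'X)) :
  [/\ p`_0 = 1, p`_1 = cc (esym1 l) & p`_2 = cc (esym2 l)].
Proof.
rewrite {}/p; elim: l => [|b l [h0 h1 h2]] /=; first by rewrite big_nil !coef1.
rewrite big_cons mulrDl mul1r -scalerAl !coefD !coefZ !coefXM /= h0 h1 h2 !mulr0 mulr1.
by rewrite addr0 ccD ccD ccM addrC.
Qed.

(** A nonzero constant term excludes the root $0$, so $X-z=-z(1-z^{-1}X)$ for each root, and $-1/z$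
    stays in the closed lower half-plane with $z$. The bound on [N] puts the indices $1$ and $2$ in
    range. *)
Lemma stable_one_prod (c : nat -> C) N : (2 <= N)%coq_nat -> c 0%N <> C0 ->
  (forall w, Rlt R0 (CIm w) -> sum_n (fun k => c k * Cpow w k)%C N <> C0) ->
  exists l, [/\ List.Forall (fun b => Rle (CIm b) R0) l,
    c 1%N = (c 0%N * esym1 l)%C, c 2%N = (c 0%N * esym2 l)%C &
    forall w, sum_n (fun k => c k * Cpow w k)%C N = (c 0%N * one_prod w l)%C].
Proof.
move=> /ssrnat.leP hN c0 /upper_roots[r [a [a0 eP hr]]].
have c0' : cc (c 0%N) != 0 by apply: cc_neq0.
have e0 : cc (c 0%N) = a * \prod_(z <- r) (- z).
  have := congr1 (fun p : {poly Ri} => p.[0]) eP.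
  rewrite hornerZ horner_prod horner_coef0 coef_poly /= => ->.
  by congr (_ * _); apply: eq_bigr => z _; rewrite hornerXsubC sub0r.
have rn0 z : z \in r -> z != 0.
  move=> zr; apply: contraNneq c0' => z0; rewrite e0 mulf_eq0 prodf_seq_eq0.
  by apply/orP; right; apply/hasP; exists z => //=; rewrite z0 oppr0.
pose l := [seq uc (- z^-1) | z <- r].
have eP2 : \poly_(i < N.+1) cc (c i) = cc (c 0%N) *: \prod_(z <- map cc l) (1 + z *: 'X).
  rewrite eP e0 -scalerA; congr (_ *: _).
  rewrite big_map big_map -scaler_prod.
  rewrite !big_seq; apply: eq_bigr => z /rn0 z0.
  rewrite ucK scalerDr scalerA mulrNN divff // scale1r addrC -[z%:P]alg_polyC.
  by rewrite scaleNr alg_polyC.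
have [h0 h1 h2] := coef_one_prod l.
have hk k : (k <= N)%N -> cc (c k) = cc (c 0%N) * (\prod_(z <- map cc l) (1 + z *: 'X))`_k.
  by move=> hkN; rewrite -coefZ -eP2 coef_poly ltnS hkN.
exists l; split.
- apply/List.Forall_forall => b /List.in_map_iff[z [<- zr]].
  have zr' : z \in r.
    elim: (r) zr => //= y s IH [->|/IH]; rewrite inE ?eqxx // => ->; exact: orbT.
  apply/RleP => /=; rewrite ImN oppr_le0; have := allP hr _ zr'.
  rewrite /= le_eqVlt => /orP[/eqP|/Im_inv/ltW //].
  by case: (z) => x y /= ->; rewrite mul0r oppr0.
- by apply: cc_inj; rewrite ccM -h1 -hk // (leq_trans _ hN).
- by apply: cc_inj; rewrite ccM -h2 -hk.
- by move=> w; apply: cc_inj; rewrite cc_horner eP2 hornerZ ccM cc_one_prod.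
Qed.

End Roots.

Import Roots.

(** * Polynomials without zeros in the upper half-plane *)

Ltac cring := match goal with |- @eq _ ?a ?b => change (@eq C a b); ring end.

Definition pol (c : nat -> C) (N : nat) (w : C) : C :=
  sum_n (fun k => (c k * Cpow w k)%C) N.

Lemma csum_O (f : nat -> C) : sum_n f 0 = f 0%nat.
Proof. apply sum_O. Qed.

Lemma csum_S (f : nat -> C) N : sum_n f (S N) = (sum_n f N + f (S N))%C.
Proof. exact (sum_Sn f N). Qed.

Lemma csum_ext (f g : nat -> C) N :
  (forall k, (k <= N)%nat -> f k = g k) -> sum_n f N = sum_n g N.
Proof. intros H; apply sum_n_ext_loc; exact H. Qed.

Lemma csum_plus (f g : nat -> C) N :
  sum_n (fun k => f k + g k)%C N = (sum_n f N + sum_n g N)%C.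
Proof. exact (sum_n_plus f g N). Qed.

Lemma csum_mult_l (a : C) (f : nat -> C) N :
  sum_n (fun k => a * f k)%C N = (a * sum_n f N)%C.
Proof. exact (sum_n_mult_l a f N). Qed.

Lemma csum_mult_r (a : C) (f : nat -> C) N :
  sum_n (fun k => f k * a)%C N = (sum_n f N * a)%C.
Proof. exact (sum_n_mult_r a f N). Qed.

Lemma csum_zero (f : nat -> C) N :
  (forall k, (k <= N)%nat -> f k = 0%C) -> sum_n f N = RtoC 0.
Proof.
  intros H. induction N as [|N IH].
  - rewrite csum_O. now apply H.
  - rewrite csum_S, IH, H by (intros; auto). cring.
Qed.

Lemma csum_trunc (f : nat -> C) N M : (N <= M)%nat ->
  (forall k, (N < k)%nat -> f k = 0%C) -> sum_n f M = sum_n f N.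
Proof.
  intros H Hf. induction H as [|M H IH]; [reflexivity|].
  rewrite csum_S, IH, Hf by lia. cring.
Qed.

Lemma Cmod_csum (f : nat -> C) N :
  Cmod (sum_n f N) <= sum_n (fun k => Cmod (f k)) N.
Proof.
  induction N as [|N IH].
  - rewrite csum_O, sum_O. lra.
  - rewrite csum_S, sum_Sn. eapply Rle_trans; [apply Cmod_triangle|].
    apply Rplus_le_compat_r, IH.
Qed.

Lemma Cmod_pow (w : C) k : Cmod (Cpow w k) = Cmod w ^ k.
Proof.
  induction k as [|k IH]; simpl; [apply Cmod_1|].
  now rewrite Cmod_mult, IH.
Qed.

Lemma Cmod_INR n : Cmod (RtoC (INR n)) = INR n.
Proof. rewrite Cmod_R. apply Rabs_pos_eq, pos_INR. Qed.

Lemma rsum_le (f g : nat -> R) N :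
  (forall k, (k <= N)%nat -> f k <= g k) -> sum_n f N <= sum_n g N.
Proof.
  intros H. induction N as [|N IH].
  - rewrite !sum_O. now apply H.
  - rewrite !sum_Sn. apply Rplus_le_compat; auto.
Qed.

Lemma rsum_S (f : nat -> R) N : sum_n f (S N) = sum_n f N + f (S N).
Proof. exact (sum_Sn f N). Qed.

Lemma is_poly_comp_pow f k : is_poly f -> is_poly (fun w => Cpow (f w) k).
Proof.
  intros Hf. induction k as [|k IH]; simpl.
  - apply is_poly_const.
  - apply is_poly_mult; [apply Hf | apply IH].
Qed.

Lemma is_poly_sum (f : nat -> C -> C) N :
  (forall k, is_poly (f k)) -> is_poly (fun w => sum_n (fun k => f k w) N).
Proof.
  intros Hf. induction N as [|N IH].
  - apply is_poly_ext with (f := f 0%nat); [|apply Hf].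
    intros w. now rewrite csum_O.
  - eapply is_poly_ext.
    + intros w. symmetry. apply csum_S.
    + apply is_poly_plus; [apply IH | apply Hf].
Qed.

Lemma is_poly_pol c N : is_poly (pol c N).
Proof.
  apply is_poly_sum. intros k.
  apply is_poly_mult; [apply is_poly_const | apply is_poly_comp_pow, is_poly_id].
Qed.

Lemma is_poly_poly2_eval N c f g : is_poly f -> is_poly g ->
  is_poly (fun t => poly2_eval N c (f t) (g t)).
Proof.
  intros Hf Hg. apply is_poly_sum; intros i. apply is_poly_sum; intros j.
  apply is_poly_mult; [apply is_poly_const|].
  apply is_poly_mult; now apply is_poly_comp_pow.
Qed.

Definition upper_stable (g : C -> C) : Prop := forall w, 0 < Im w -> g w <> 0%C.

Lemma lin_prod_root x l : In x l -> lin_prod x l = 0%C.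
Proof.
  induction l as [|a l IH]; simpl; [tauto|].
  intros [-> | H]; [ring|]. rewrite (IH H). ring.
Qed.

Lemma upper_stable_factor g : is_poly g -> upper_stable g ->
  exists (a : C) (l : list C), a <> 0%C /\ List.Forall (fun z => Im z <= 0) l /\
    forall w, g w = (a * lin_prod w l)%C.
Proof.
  intros Hp Hs. destruct (is_poly_factor g Hp) as [H | (a & l & Ha & H)].
  - exfalso. apply (Hs Ci); [simpl; lra | apply H].
  - exists a, l. repeat split; auto. apply List.Forall_forall. intros z Hz.
    destruct (Rle_or_lt (Im z) 0) as [|Hlt]; [assumption|].
    exfalso. apply (Hs z Hlt). rewrite H, (lin_prod_root z l Hz). ring.
Qed.

Lemma Cmod_le_compat (x1 y1 x2 y2 : R) :
  x1 ^ 2 + y1 ^ 2 <= x2 ^ 2 + y2 ^ 2 -> Cmod (x1, y1) <= Cmod (x2, y2).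
Proof. intros H. apply sqrt_le_1_alt. exact H. Qed.

(** Factor by factor: for a root $u+iv$ with $v\le0$, $(y-v)^2-(y'-v)^2=(y-y')(y+y'-2v)\ge0$. *)
Lemma upper_stable_mono g x y y' : is_poly g -> upper_stable g ->
  - y <= y' <= y -> Cmod (g (x, y')) <= Cmod (g (x, y)).
Proof.
  intros Hp Hs Hy. destruct (upper_stable_factor g Hp Hs) as (a & l & _ & Hl & H).
  rewrite !H, !Cmod_mult. apply Rmult_le_compat_l; [apply Cmod_ge_0|].
  clear H. induction Hl as [|[u v] l Hv Hl IH]; simpl; [lra|].
  rewrite !Cmod_mult. apply Rmult_le_compat; try apply Cmod_ge_0; [|exact IH].
  apply Cmod_le_compat. simpl in *. nra.
Qed.

Lemma vertical_avoid (x : R) (l : list C) : exists y0 : R, 0 < y0 /\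
  forall y, 0 < y <= y0 -> ~ In (x, y) l.
Proof.
  induction l as [|[u v] l (y0 & Hy0 & IH)].
  - exists 1. split; [lra|]. intros y _ [].
  - destruct (Rlt_or_le 0 v) as [Hv|Hv].
    + exists (Rmin y0 (v / 2)). split.
      * apply Rmin_glb_lt; lra.
      * intros y Hy [E|E].
        -- injection E as <- <-. pose proof (Rmin_r y0 (v / 2)). lra.
        -- apply (IH y); auto. pose proof (Rmin_l y0 (v / 2)). lra.
    + exists y0. split; auto. intros y Hy [E|E].
      * injection E as <- <-. lra.
      * now apply (IH y).
Qed.

Lemma lin_prod_neq0 w l : ~ In w l -> lin_prod w l <> 0%C.
Proof.
  induction l as [|a l IH]; simpl; intros H.
  - intros E. injection E. intros; lra.
  - apply Cmult_neq_0; [|tauto]. intros E. apply H. left.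
    replace a with (w - (w - a))%C by ring. rewrite E. ring.
Qed.

(** A nonzero polynomial has finitely many roots, so it cannot vanish at all points near the lower
    end of the segment. *)
Lemma is_poly_vertical_zero g x y0 : is_poly g -> 0 < y0 ->
  (forall y, 0 < y <= y0 -> g (x, y) = 0%C) -> forall w, g w = 0%C.
Proof.
  intros Hp Hy0 H0. destruct (is_poly_factor g Hp) as [H | (a & l & Ha & H)]; auto.
  exfalso. destruct (vertical_avoid x l) as (y1 & Hy1 & Hav).
  pose proof (Rmin_l y0 y1). pose proof (Rmin_r y0 y1).
  assert (0 < Rmin y0 y1) by (apply Rmin_glb_lt; lra).
  specialize (H0 (Rmin y0 y1) ltac:(lra)). rewrite H in H0.
  revert H0. apply Cmult_neq_0; auto. apply lin_prod_neq0, Hav. lra.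
Qed.

(** * Cauchy's estimate *)

Lemma csum_single (f : nat -> C) N k : (k <= N)%nat ->
  (forall j, (j <= N)%nat -> j <> k -> f j = 0%C) -> sum_n f N = f k.
Proof.
  induction N as [|N IH]; intros Hk H.
  - rewrite csum_O. now replace k with 0%nat by lia.
  - rewrite csum_S. destruct (Nat.eq_dec k (S N)) as [->|Hne].
    + rewrite csum_zero by (intros; apply H; lia). cring.
    + rewrite IH, (H (S N)) by (try lia; intros; apply H; lia). cring.
Qed.

Lemma Cpow_add_r (w : C) m n : Cpow w (m + n) = (Cpow w m * Cpow w n)%C.
Proof. induction m as [|m IH]; simpl; [|rewrite IH]; ring. Qed.

Lemma Cpow_mult_l (w z : C) n : Cpow (w * z) n = (Cpow w n * Cpow z n)%C.
Proof. induction n as [|n IH]; simpl; [|rewrite IH]; ring. Qed.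

Lemma Cpow_mult_r (w : C) m n : Cpow w (m * n) = Cpow (Cpow w m) n.
Proof.
  induction m as [|m IH]; simpl.
  - induction n as [|n IHn]; simpl; [|rewrite <- IHn]; ring.
  - now rewrite Cpow_add_r, IH, Cpow_mult_l.
Qed.

Definition cis (t : R) : C := (cos t, sin t).

Lemma Cmod_cis t : Cmod (cis t) = 1.
Proof.
  rewrite <- sqrt_1. unfold Cmod, cis. f_equal. unfold fst, snd.
  pose proof (sin2_cos2 t) as H. unfold Rsqr in H. lra.
Qed.

Lemma cis_pow t k : Cpow (cis t) k = cis (INR k * t).
Proof.
  induction k as [|k IH].
  - unfold cis. simpl. rewrite Rmult_0_l, cos_0, sin_0. reflexivity.
  - change (Cpow (cis t) (S k)) with (cis t * Cpow (cis t) k)%C. rewrite IH, S_INR.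
    replace ((INR k + 1) * t) with (t + INR k * t) by ring.
    unfold cis. rewrite cos_plus, sin_plus. unfold Cmult; simpl. f_equal; ring.
Qed.

Lemma geom_csum (u : C) N :
  ((1 - u) * sum_n (fun s => Cpow u s) N)%C = (1 - Cpow u (S N))%C.
Proof.
  induction N as [|N IH].
  - rewrite csum_O. simpl. ring.
  - rewrite csum_S, Cmult_plus_distr_l, IH. simpl. ring.
Qed.

(** From $\cos t=1-2\sin^2(t/2)$. The range extends to $4\pi$ because the exponents in
    [root_unity_sum] run through two periods. *)
Lemma cis_eq1 t : 0 < t < 4 * PI -> cis t = 1%C -> t = 2 * PI.
Proof.
  intros Ht E. injection E as Ec Es.
  replace t with (2 * (t / 2)) in Ec by field. rewrite cos_2a_sin in Ec.
  assert (Hs : sin (t / 2) = 0) by nra.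
  destruct (Rtotal_order (t / 2) PI) as [H|[H|H]].
  - pose proof (sin_gt_0 (t / 2) ltac:(lra) H). lra.
  - lra.
  - pose proof (sin_lt_0 (t / 2) ltac:(lra) ltac:(lra)). lra.
Qed.

Lemma root_unity_sum N e (w := cis (2 * PI / INR (S N))) :
  (0 < e < 2 * S N)%nat -> e <> S N ->
  sum_n (fun s => Cpow (Cpow w e) s) N = RtoC 0.
Proof.
  intros He Hne. set (M := INR (S N)) in *.
  assert (HM : 0 < M) by (apply lt_0_INR; lia).
  pose proof PI_RGT_0 as HPI.
  set (u := Cpow w e).
  assert (Hu : Cpow u (S N) = 1%C).
  { unfold u. rewrite <- Cpow_mult_r, Nat.mul_comm, Cpow_mult_r.
    unfold w. rewrite cis_pow. fold M.
    replace (M * (2 * PI / M)) with (2 * PI) by (field; lra).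
    unfold cis. rewrite cos_2PI, sin_2PI. change (Cpow 1 e = 1%C).
    clear. induction e as [|e IH]; simpl; [reflexivity|]. rewrite IH. ring. }
  assert (Hu1 : u <> 1%C).
  { unfold u, w. rewrite cis_pow. intros E. apply cis_eq1 in E.
    - apply Hne, INR_eq. fold M.
      apply Rmult_eq_reg_r with (2 * PI / M); [|apply Rgt_not_eq, Rdiv_lt_0_compat; lra].
      rewrite E. field. lra.
    - assert (0 < INR e) by (apply lt_0_INR; lia).
      assert (INR e < 2 * M).
      { unfold M. change 2 with (INR 2). rewrite <- mult_INR. apply lt_INR. lia. }
      split.
      + apply Rmult_lt_0_compat; auto. apply Rdiv_lt_0_compat; lra.
      + apply Rlt_le_trans with (2 * M * (2 * PI / M)).
        * apply Rmult_lt_compat_r; auto. apply Rdiv_lt_0_compat; lra.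
        * right. field. lra. }
  pose proof (geom_csum u N) as G. rewrite Hu in G.
  set (X := sum_n _ _) in *. change C in (type of X).
  assert (Hd : (1 - u)%C <> 0%C).
  { intros E. apply Hu1. replace u with (1 - (1 - u))%C by ring. rewrite E. ring. }
  replace X with (/ (1 - u) * ((1 - u) * X))%C by (field; exact Hd).
  rewrite G. cring.
Qed.

Lemma Cpow_one n : Cpow 1 n = 1%C.
Proof. induction n as [|n IH]; simpl; [|rewrite IH]; ring. Qed.

(* Averages over the (N+1)-st roots of unity replace the contour integral. *)
Lemma cauchy_estimate c N r B k : 0 <= r -> (k <= N)%nat ->
  (forall w, Cmod w = r -> Cmod (pol c N w) <= B) ->
  Cmod (c k) * r ^ k <= B.
Proof.
  intros Hr Hk HB. set (M := INR (S N)).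
  assert (HM : 0 < M) by (apply lt_0_INR; lia).
  set (w := cis (2 * PI / M)).
  (* The weight $w^{s(N+1-k)}$ equals $w^{-sk}$ and avoids negative powers. *)
  set (S1 := sum_n (fun s => pol c N (RtoC r * Cpow w s) * Cpow (Cpow w s) (S N - k))%C N).
  assert (E : S1 = (c k * Cpow (RtoC r) k * RtoC M)%C).
  { unfold S1. transitivity (sum_n (fun s => sum_n (fun j =>
      (c j * Cpow (RtoC r) j * Cpow (Cpow w (j + (S N - k))) s)%C) N) N).
    - apply csum_ext. intros s _. unfold pol. rewrite <- csum_mult_r.
      apply csum_ext. intros j _.
      rewrite Cpow_mult_l, <- !Cpow_mult_r, Nat.mul_add_distr_r, Cpow_add_r.
      rewrite (Nat.mul_comm j s), (Nat.mul_comm (S N - k) s). cring.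
    - rewrite sum_n_switch.
      (* After the interchange only $j=k$ survives: its exponent is $N+1$, so each of the $N+1$
         powers is $1$. *)
      rewrite (csum_single _ N k Hk).
      + rewrite csum_mult_l. apply (f_equal (Cmult (c k * Cpow (RtoC r) k)%C)).
        replace (k + (S N - k))%nat with (S N) by lia.
        assert (Hw : Cpow w (S N) = 1%C).
        { unfold w. rewrite cis_pow. fold M.
          replace (M * (2 * PI / M)) with (2 * PI) by (field; lra).
          unfold cis. rewrite cos_2PI, sin_2PI. reflexivity. }
        rewrite Hw. unfold M. clear. induction N as [|N IH].
        * rewrite csum_O. simpl. reflexivity.
        * rewrite csum_S, IH, Cpow_one, (S_INR (S N)), RtoC_plus. reflexivity.
      + intros j Hj Hjk. rewrite csum_mult_l.
        assert (Hz : sum_n (fun s => Cpow (Cpow w (j + (S N - k))) s) N = RtoC 0)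
          by (apply (root_unity_sum N); lia).
        eapply eq_trans; [exact (f_equal (Cmult _) Hz)|]. cring. }
  assert (HS : Cmod S1 <= M * B).
  { eapply Rle_trans; [apply Cmod_csum|].
    eapply Rle_trans; [apply (rsum_le _ (fun _ => B))|].
    - intros s _. rewrite Cmod_mult, !Cmod_pow. unfold w at 2. rewrite Cmod_cis, !pow1, Rmult_1_r.
      apply HB. rewrite Cmod_mult, Cmod_pow, Cmod_R. unfold w. rewrite Cmod_cis, pow1, Rabs_pos_eq; lra.
    - rewrite sum_n_const. unfold M. lra. }
  rewrite E, !Cmod_mult, Cmod_pow, !Cmod_R, (Rabs_pos_eq r), (Rabs_pos_eq M) in HS by lra.
  nra.
Qed.

Lemma pol_zero_coef c N : (forall w, pol c N w = 0%C) -> forall k, (k <= N)%nat -> c k = 0%C.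
Proof.
  intros H k Hk. apply Cmod_eq_0, Rle_antisym; [|apply Cmod_ge_0].
  assert (E := cauchy_estimate c N 1 0 k ltac:(lra) Hk). rewrite pow1, Rmult_1_r in E.
  apply E. intros w _. rewrite H, Cmod_0. lra.
Qed.

(** * Power series *)

Lemma is_series_eps (a : nat -> C) (l : C) :
  is_series a l <->
  forall eps, 0 < eps -> exists M, forall n, (M <= n)%nat -> Cmod (sum_n a n - l)%C < eps.
Proof.
  unfold is_series. split.
  - intros H eps He.
    destruct (proj1 (filterlim_locally_ball_norm _ _) H (mkposreal eps He)) as [M HM].
    exists M. exact HM.
  - intros H. apply (proj2 (filterlim_locally_ball_norm _ _)).
    intros [eps He]. destruct (H eps He) as [M HM]. exists M. exact HM.
Qed.

Lemma Cmod_minus_sym (x y : C) : Cmod (x - y) = Cmod (y - x).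
Proof. rewrite <- Cmod_opp. f_equal. ring. Qed.

Lemma Cmod_minus_triangle (x y z : C) : Cmod (x - z) <= Cmod (x - y) + Cmod (y - z).
Proof. replace (x - z)%C with ((x - y) + (y - z))%C by ring. apply Cmod_triangle. Qed.

Lemma Cmod_le_of_near (x : C) B :
  (forall eps, 0 < eps -> exists y : C, Cmod y <= B /\ Cmod (y - x) < eps) -> Cmod x <= B.
Proof.
  intros H. apply le_epsilon. intros eps He. destruct (H eps He) as (y & Hy & Hyx).
  replace x with (y - (y - x))%C by ring.
  eapply Rle_trans; [apply Cmod_triangle|]. rewrite Cmod_opp. lra.
Qed.

Lemma series_terms_bounded (a : nat -> C) (l : C) : is_series a l ->
  exists B, forall k, Cmod (a k) <= B.
Proof.
  intros H. destruct (proj1 (is_series_eps a l) H 1 ltac:(lra)) as [M HM].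
  set (A0 := sum_n (fun k => Cmod (a k)) M).
  assert (Hpos : forall n, 0 <= sum_n (fun k => Cmod (a k)) n).
  { induction n as [|n IH]; [rewrite sum_O; apply Cmod_ge_0|].
    rewrite rsum_S. pose proof (Cmod_ge_0 (a (S n))). lra. }
  assert (HA : forall n k, (k <= n)%nat -> Cmod (a k) <= sum_n (fun k => Cmod (a k)) n).
  { induction n as [|n IH]; intros k Hk.
    - rewrite sum_O. replace k with 0%nat by lia. lra.
    - rewrite rsum_S. destruct (Nat.eq_dec k (S n)) as [->|Hne].
      + specialize (Hpos n). lra.
      + pose proof (Cmod_ge_0 (a (S n))). pose proof (IH k ltac:(lia)). lra. }
  (* Up to [M] a term is at most the sum [A0]; beyond, it is a difference of two partial sums that
     are both within $1$ of the limit. *)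
  exists (A0 + 2). intros k. destruct (Compare_dec.le_gt_dec k M) as [Hk|Hk].
  - specialize (HA M k Hk). unfold A0. lra.
  - destruct k as [|k]; [lia|].
    pose proof (HM k ltac:(lia)) as H1. pose proof (HM (S k) ltac:(lia)) as H2.
    rewrite csum_S in H2. specialize (Hpos M). fold A0 in Hpos.
    set (X := sum_n a k) in *. change C in (type of X).
    replace (a (S k)) with ((X + a (S k) - l) - (X - l))%C by ring.
    eapply Rle_trans; [apply Cmod_triangle|]. rewrite Cmod_opp. lra.
Qed.

(** With $x=|w|/\rho\le1/2$, each term is at most $Bx^n\le2B(x^n-x^{n+1})$, and the right-hand sides
    telescope. *)
Lemma pol_tail (a : nat -> C) w rho B L m : 0 < rho -> Cmod w <= rho / 2 ->
  (forall k, Cmod (a k) * rho ^ k <= B) ->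
  Cmod (pol a (L + m) w - pol a L w)%C
    <= 2 * B * ((Cmod w / rho) ^ S L - (Cmod w / rho) ^ S (L + m)).
Proof.
  intros Hr Hw HB. set (x := Cmod w / rho).
  assert (Hx : 0 <= x <= 1 / 2).
  { unfold x. split.
    - apply Rmult_le_pos; [apply Cmod_ge_0 | left; now apply Rinv_0_lt_compat].
    - apply Rmult_le_reg_r with rho; auto. field_simplify; lra. }
  induction m as [|m IH].
  - rewrite Nat.add_0_r. replace (pol a L w - pol a L w)%C with (RtoC 0) by ring.
    rewrite Cmod_0. lra.
  - rewrite Nat.add_succ_r. unfold pol at 1. rewrite csum_S. fold (pol a (L + m) w).
    set (n := S (L + m)) in *.
    replace (pol a (L + m) w + a n * Cpow w n - pol a L w)%C
      with ((pol a (L + m) w - pol a L w) + a n * Cpow w n)%C by ring.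
    eapply Rle_trans; [apply Cmod_triangle|].
    assert (Ht : Cmod (a n * Cpow w n) <= B * x ^ n).
    { rewrite Cmod_mult, Cmod_pow. replace (Cmod w) with (rho * x) by (unfold x; field; lra).
      rewrite Rpow_mult_distr, <- Rmult_assoc.
      apply Rmult_le_compat_r; [apply pow_le; lra | apply HB]. }
    assert (0 <= B * x ^ n) by (eapply Rle_trans; [apply Cmod_ge_0 | exact Ht]).
    change (x ^ S n) with (x * x ^ n). nra.
Qed.

Lemma series_tail (a : nat -> C) (f w : C) rho B L :
  is_series (fun k => a k * Cpow w k)%C f ->
  0 < rho -> Cmod w <= rho / 2 ->
  (forall k, Cmod (a k) * rho ^ k <= B) ->
  Cmod (f - pol a L w) <= 2 * B * (Cmod w / rho) ^ S L.
Proof.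
  intros Hf Hr Hw HB. apply Cmod_le_of_near. intros eps He.
  destruct (proj1 (is_series_eps _ _) Hf eps He) as [M HM].
  exists (pol a (L + M) w - pol a L w)%C. split.
  - eapply Rle_trans; [apply (pol_tail a w rho B); auto|].
    assert (0 <= B).
    { eapply Rle_trans; [|apply (HB 0%nat)]. apply Rmult_le_pos; [apply Cmod_ge_0 | simpl; lra]. }
    assert (0 <= (Cmod w / rho) ^ S (L + M)).
    { apply pow_le, Rmult_le_pos; [apply Cmod_ge_0 | left; now apply Rinv_0_lt_compat]. }
    nra.
  - specialize (HM (L + M)%nat ltac:(lia)). unfold pol at 1.
    match goal with |- Cmod ?z < _ => replace z with (pol a (L + M) w - f)%C by (unfold pol; ring) end.
    exact HM.
Qed.

(** The terms of the convergent series at $w=2$ are bounded. With radius $2$, the unit disc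
    satisfies the condition $|w|\le\rho/2$ of [series_tail]. *)
Lemma entire_coef_bounded (a : nat -> C) (f : C -> C) :
  (forall w, is_series (fun k => a k * Cpow w k)%C (f w)) ->
  exists B, forall k, Cmod (a k) * 2 ^ k <= B.
Proof.
  intros H. destruct (series_terms_bounded _ _ (H (RtoC 2))) as [B HB].
  exists B. intros k. specialize (HB k). rewrite Cmod_mult, Cmod_pow, Cmod_R in HB.
  rewrite Rabs_pos_eq in HB by lra. exact HB.
Qed.

Lemma pow_half_small eps B : 0 < eps -> exists L, forall n, (L <= n)%nat -> B * (1 / 2) ^ n < eps.
Proof.
  intros He. destruct (pow_lt_1_zero (1 / 2) ltac:(rewrite Rabs_pos_eq; lra)
    (eps / (Rabs B + 1))) as [L HL].
  { apply Rdiv_lt_0_compat; auto. pose proof (Rabs_pos B). lra. }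
  exists L. intros n Hn. specialize (HL n ltac:(lia)).
  rewrite Rabs_pos_eq in HL by (apply pow_le; lra).
  pose proof (Rabs_pos B). pose proof (Rle_abs B).
  assert (0 <= (1/2)^n) by (apply pow_le; lra).
  apply Rmult_lt_compat_r with (r := Rabs B + 1) in HL; [|lra].
  unfold Rdiv in HL at 2. rewrite Rmult_assoc, Rinv_l in HL by lra. nra.
Qed.

Lemma pol_extend (c : nat -> C) N M w : (N <= M)%nat -> (forall k, (N < k)%nat -> c k = 0%C) ->
  pol c M w = pol c N w.
Proof.
  intros H Hc. apply csum_trunc; auto. intros k Hk. rewrite Hc by auto. ring.
Qed.

Lemma pol_minus (c a : nat -> C) N w : pol (fun k => c k - a k)%C N w = (pol c N w - pol a N w)%C.
Proof.
  unfold pol.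
  transitivity (sum_n (fun k => c k * Cpow w k + (-(1)) * (a k * Cpow w k))%C N).
  - apply csum_ext. intros k _. cring.
  - rewrite csum_plus, csum_mult_l. cring.
Qed.

(** Cauchy's estimate on the unit circle, applied to the polynomial minus a long partial sum of the
    series; the neglected tail is arbitrarily small there. *)
Lemma coef_close (a c : nat -> C) (f : C -> C) N eps :
  (forall w, is_series (fun k => a k * Cpow w k)%C (f w)) ->
  (forall k, (N < k)%nat -> c k = 0%C) ->
  (forall w, Cmod w <= 1 -> Cmod (pol c N w - f w) < eps) ->
  forall k, Cmod (c k - a k) <= eps.
Proof.
  intros Hf Hc He k. destruct (entire_coef_bounded a f Hf) as [B HB].
  apply le_epsilon. intros e' He'.
  destruct (pow_half_small e' (2 * B) He') as [L HL].
  (* [N] keeps the whole polynomial, [k] the coefficient in question, and [L] makes the tail smaller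
     than [e']. *)
  set (n := (N + k + L)%nat).
  assert (E := cauchy_estimate (fun k => c k - a k)%C n 1 (eps + e') k ltac:(lra) ltac:(lia)).
  rewrite pow1, Rmult_1_r in E. apply E. intros w Hw.
  rewrite pol_minus, (pol_extend c N n) by (auto; lia).
  eapply Rle_trans; [apply (Cmod_minus_triangle _ (f w))|].
  specialize (He w ltac:(lra)).
  pose proof (series_tail a (f w) w 2 B n (Hf w) ltac:(lra) ltac:(lra) HB) as T.
  rewrite Hw in T. specialize (HL (S n) ltac:(lia)). lra.
Qed.

(** * Limits of stable polynomials *)

Lemma poly2_eval_pol N c z w :
  poly2_eval N c z w = pol (fun j => pol (fun i => c i j) N z) N w.
Proof.
  unfold poly2_eval. rewrite sum_n_switch. apply csum_ext. intros j _.
  unfold pol. rewrite <- csum_mult_r. apply csum_ext. intros i _. cring.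
Qed.

Lemma in_H2_slice g z : in_H2 g ->
  exists N (q : nat -> C), (forall k, (N < k)%nat -> q k = 0%C) /\
    forall w, g z w = pol q N w.
Proof.
  intros (N & c & Hb & _ & Hg & _).
  exists N, (fun j => pol (fun i => c i j) N z). split.
  - intros k Hk. apply csum_zero. intros i _. rewrite Hb by auto. cring.
  - intros w. rewrite Hg. apply poly2_eval_pol.
Qed.

Lemma in_H2_is_poly g f h : in_H2 g -> is_poly f -> is_poly h ->
  is_poly (fun t => g (f t) (h t)).
Proof.
  intros (N & c & _ & _ & Hg & _) Hf Hh.
  apply is_poly_ext with (f := fun t => poly2_eval N c (f t) (h t)).
  - intros t. now rewrite Hg.
  - now apply is_poly_poly2_eval.
Qed.

Lemma in_H2_nonzero g z w : in_H2 g -> 0 < Im z -> 0 < Im w -> g z w <> 0%C.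
Proof. intros (N & c & _ & _ & _ & H). apply H. Qed.

Lemma falling_gt n k : (n < k)%nat -> Defs.falling n k = 0%nat.
Proof.
  induction k as [|k IH]; intros H; [lia|]. simpl.
  destruct (Nat.eq_dec n k) as [->|Hne]; [rewrite Nat.sub_diag; lia|].
  rewrite IH; lia.
Qed.

Lemma falling_neq0 n k : (k <= n)%nat -> Defs.falling n k <> 0%nat.
Proof.
  induction k as [|k IH]; intros H; simpl; [lia|].
  apply Nat.neq_mul_0. split; [apply IH; lia | lia].
Qed.

Lemma least_nat (Q : nat -> Prop) n : Q n ->
  exists m, (m <= n)%nat /\ Q m /\ forall k, (k < m)%nat -> ~ Q k.
Proof.
  induction n as [n IH] using (well_founded_induction lt_wf). intros Hn.
  destruct (classic (exists k, (k < n)%nat /\ Q k)) as [(k & Hk & HQ)|H].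
  - destruct (IH k Hk HQ) as (m & Hm & HQm & Hl). exists m. repeat split; auto; lia.
  - exists n. repeat split; auto. intros k Hk HQ. apply H. now exists k.
Qed.

(** The image of $\sum c_kw^k$ under $w^k\mapsto(n)_kw^k$; stopping at $n$ loses nothing because
    $(n)_k=0$ afterwards. *)
Definition fpol (n : nat) (c : nat -> C) : C -> C :=
  pol (fun k => RtoC (INR (Defs.falling n k)) * c k)%C n.

Lemma fpol_extend n (c : nat -> C) M w : (n <= M)%nat ->
  pol (fun k => RtoC (INR (Defs.falling n k)) * c k)%C M w = fpol n c w.
Proof.
  intros H. apply pol_extend; auto. intros k Hk. rewrite falling_gt by auto. simpl. ring.
Qed.

(** By [falling_stable] the image is either stable, hence monotone, or zero on the open upper
    half-plane, which contains both points since $v'>0$. *)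
Lemma fpol_mono n (q : nat -> C) N u v v' :
  (forall k, (N < k)%nat -> q k = 0%C) -> upper_stable (pol q N) -> 0 < v' <= v ->
  Cmod (fpol n q (u, v')) <= Cmod (fpol n q (u, v)).
Proof.
  intros Hq Hs Hv.
  assert (E : forall w, fpol n q w = pol (fun k => RtoC (INR (Defs.falling n k)) * q k)%C N w).
  { intros w. rewrite <- (fpol_extend n q (n + N)) by lia.
    apply pol_extend; [lia|]. intros k Hk. rewrite Hq by auto. ring. }
  destruct (falling_stable q N n Hs) as [H|H].
  - rewrite !E. apply upper_stable_mono; [apply is_poly_pol | exact H | lra].
  - rewrite !E. unfold pol. rewrite !H by (simpl; lra). lra.
Qed.

Lemma rsum_mult_l (a : R) (f : nat -> R) N :
  sum_n (fun k => a * f k) N = a * sum_n f N.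
Proof. exact (sum_n_mult_l a f N). Qed.

Lemma fpol_close n (p q : nat -> C) eps w : (forall k, Cmod (q k - p k) <= eps) ->
  Cmod (fpol n q w - fpol n p w)
    <= eps * sum_n (fun k => INR (Defs.falling n k) * Cmod w ^ k) n.
Proof.
  intros H. unfold fpol. rewrite <- pol_minus.
  eapply Rle_trans; [apply Cmod_csum|].
  rewrite <- (rsum_mult_l eps). apply rsum_le. intros k _.
  match goal with |- Cmod ?z <= _ =>
    replace z with (RtoC (INR (Defs.falling n k)) * (q k - p k) * Cpow w k)%C by ring end.
  rewrite !Cmod_mult, Cmod_pow, Cmod_INR.
  assert (0 <= INR (Defs.falling n k)) by apply pos_INR.
  assert (0 <= Cmod w ^ k) by (apply pow_le, Cmod_ge_0).
  replace (eps * (INR (Defs.falling n k) * Cmod w ^ k))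
    with (INR (Defs.falling n k) * eps * Cmod w ^ k) by ring.
  apply Rmult_le_compat_r; auto. apply Rmult_le_compat_l; auto.
Qed.

Lemma Cmod_le_limit (x y : C) K :
  (forall eps, 0 < eps -> exists x' y' : C,
     Cmod (x' - x) <= eps * K /\ Cmod (y' - y) <= eps * K /\ Cmod x' <= Cmod y') ->
  Cmod x <= Cmod y.
Proof.
  intros H. apply le_epsilon. intros e He. pose proof (Rabs_pos K). pose proof (Rle_abs K).
  set (eps := e / (2 * (Rabs K + 1))).
  assert (Hpos : 0 < eps) by (apply Rdiv_lt_0_compat; lra).
  destruct (H eps Hpos) as (x' & y' & Hx & Hy & Hxy).
  assert (Hk : eps * K <= e / 2).
  { apply Rle_trans with (eps * (Rabs K + 1)); [apply Rmult_le_compat_l; lra|].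
    right. unfold eps. field. lra. }
  assert (Cmod x <= Cmod x' + Cmod (x' - x)).
  { replace x with (x' + - (x' - x))%C at 1 by ring.
    eapply Rle_trans; [apply Cmod_triangle|]. rewrite Cmod_opp. lra. }
  assert (Cmod y' <= Cmod y + Cmod (y' - y)).
  { replace y' with (y + (y' - y))%C at 1 by ring. apply Cmod_triangle. }
  lra.
Qed.

Section Limit.

Variables (f : C -> C -> C) (a : nat -> C -> C) (Q : nat -> C -> C -> C).
Hypothesis Hf : forall z w, is_series (fun k => a k z * Cpow w k)%C (f z w).
Hypothesis HQ : forall m, in_H2 (Q m).
Hypothesis Hlim : cvg_compact Q f.

(** For fixed $z$ the coefficients in $w$ of the approximants converge, and [fpol] involves finitely
    many of them, so [fpol_mono] passes to the limit. *)
Lemma limit_fpol_mono n z u v v' : 0 < Im z -> 0 < v' <= v ->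
  Cmod (fpol n (fun k => a k z) (u, v')) <= Cmod (fpol n (fun k => a k z) (u, v)).
Proof.
  intros Hz Hv.
  set (S0 := fun w : C => sum_n (fun k => INR (Defs.falling n k) * Cmod w ^ k) n).
  assert (HS : forall w, 0 <= S0 w).
  { intros w. eapply Rle_trans; [apply Cmod_ge_0|].
    eapply Rle_trans; [apply (fpol_close n (fun _ => 0%C) (fun _ => 1%C) 1)|].
    - intros _. replace (1 - 0)%C with (RtoC 1) by ring. rewrite Cmod_1. lra.
    - rewrite Rmult_1_l. apply Rle_refl. }
  apply Cmod_le_limit with (K := S0 (u, v') + S0 (u, v)). intros eps He.
  pose proof (Cmod_ge_0 z).
  (* The radius covers both $z$ and the unit disc in $w$ on which [coef_close] works. *)
  destruct (Hlim (Cmod z + 1) eps ltac:(lra) He) as [M HM]. specialize (HM M ltac:(lia)).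
  destruct (in_H2_slice (Q M) z (HQ M)) as (N & q & Hq & HqQ).
  assert (Hc : forall k, Cmod (q k - a k z) <= eps).
  { apply (coef_close (fun k => a k z) q (f z) N eps); auto.
    intros w Hw. rewrite <- HqQ. apply HM; lra. }
  exists (fpol n q (u, v')), (fpol n q (u, v)).
  pose proof (HS (u, v)). pose proof (HS (u, v')).
  split; [|split].
  - eapply Rle_trans; [apply fpol_close, Hc|]. fold (S0 (u, v')). nra.
  - eapply Rle_trans; [apply fpol_close, Hc|]. fold (S0 (u, v)). nra.
  - apply (fpol_mono n q N); auto. intros w Hw. rewrite <- HqQ. now apply in_H2_nonzero.
Qed.

(** With $w$ fixed in the upper half-plane, every approximant is a stable polynomial in $z$. *)
Lemma limit_mono_left x y y' w : 0 < Im w -> 0 < y' <= y ->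
  Cmod (f (x, y') w) <= Cmod (f (x, y) w).
Proof.
  intros Hw Hy. apply Cmod_le_limit with (K := 1). intros eps He.
  pose proof (Cmod_ge_0 (x, y)). pose proof (Cmod_ge_0 (x, y')). pose proof (Cmod_ge_0 w).
  destruct (Hlim (Cmod (x, y) + Cmod (x, y') + Cmod w + 1) eps ltac:(lra) He) as [M HM].
  specialize (HM M ltac:(lia)).
  exists (Q M (x, y') w), (Q M (x, y) w). repeat split.
  - left. rewrite Rmult_1_r. apply HM; lra.
  - left. rewrite Rmult_1_r. apply HM; lra.
  - apply (upper_stable_mono (fun z => Q M z w)); [| |lra].
    + apply in_H2_is_poly; auto; [apply is_poly_id | apply is_poly_const].
    + intros z Hz. now apply in_H2_nonzero.
Qed.

(* Divide the monotonicity in z by w^k and let w tend to 0. *)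
Lemma limit_lowest_coef k x y y' : (forall j z, (j < k)%nat -> a j z = 0%C) ->
  0 < y' <= y -> a k (x, y) = 0%C -> a k (x, y') = 0%C.
Proof.
  intros Hlow Hy H0.
  destruct (entire_coef_bounded _ _ (Hf (x, y))) as [B1 HB1].
  destruct (entire_coef_bounded _ _ (Hf (x, y'))) as [B2 HB2].
  assert (HBp1 : 0 <= B1).
  { eapply Rle_trans; [|apply (HB1 0%nat)]. simpl. rewrite Rmult_1_r. apply Cmod_ge_0. }
  assert (HBp2 : 0 <= B2).
  { eapply Rle_trans; [|apply (HB2 0%nat)]. simpl. rewrite Rmult_1_r. apply Cmod_ge_0. }
  assert (Hpol : forall z w, pol (fun j => a j z) k w = (a k z * Cpow w k)%C).
  { intros z w. apply (csum_single (fun j => a j z * Cpow w j)%C k k); [lia|].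
    intros j Hj Hjk. rewrite Hlow by lia. ring. }
  (* At $w=it$ both $f(x+iy,w)$ and $f(x+iy',w)-a_k(x+iy')w^k$ are $O(t^{k+1})$, since
     $a_k(x+iy)=0$. *)
  assert (Hb : forall t, 0 < t <= 1 -> Cmod (a k (x, y')) <= 2 * (B1 + B2) * t).
  { intros t Ht. set (w := (0, t) : C).
    assert (Hw : Cmod w = t).
    { unfold Cmod, w; simpl. replace (0 * (0 * 1) + t * (t * 1)) with (t * t) by ring.
      apply sqrt_square. lra. }
    pose proof (series_tail _ _ w 2 B1 k (Hf (x, y) w) ltac:(lra) ltac:(lra) HB1) as T1.
    pose proof (series_tail _ _ w 2 B2 k (Hf (x, y') w) ltac:(lra) ltac:(lra) HB2) as T2.
    pose proof (limit_mono_left x y y' w ltac:(simpl; lra) Hy) as Hm.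
    rewrite Hpol in T1, T2. rewrite H0 in T1.
    replace (f (x, y) w - 0 * Cpow w k)%C with (f (x, y) w) in T1 by ring.
    assert (H3 : Cmod (a k (x, y') * Cpow w k)
                 <= Cmod (f (x, y') w) + Cmod (f (x, y') w - a k (x, y') * Cpow w k)).
    { replace (a k (x, y') * Cpow w k)%C
        with (f (x, y') w + - (f (x, y') w - a k (x, y') * Cpow w k))%C at 1 by ring.
      eapply Rle_trans; [apply Cmod_triangle|]. rewrite Cmod_opp. lra. }
    rewrite Hw in T1, T2. rewrite Cmod_mult, Cmod_pow, Hw in H3.
    assert (Hp : 0 < t ^ k) by (apply pow_lt; lra).
    assert (Hle : (t / 2) ^ S k <= t * t ^ k).
    { change (t * t ^ k) with (t ^ S k). apply pow_incr. lra. }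
    assert (Cmod (a k (x, y')) * t ^ k <= 2 * (B1 + B2) * t * t ^ k) by nra.
    apply Rmult_le_reg_r with (t ^ k); auto. }
  apply Cmod_eq_0, Rle_antisym; [|apply Cmod_ge_0].
  apply le_epsilon. intros e He. rewrite Rplus_0_l.
  set (t := Rmin 1 (e / (2 * (B1 + B2) + 1))).
  assert (Ht : 0 < t).
  { apply Rmin_glb_lt; [lra|]. apply Rdiv_lt_0_compat; lra. }
  pose proof (Rmin_l 1 (e / (2 * (B1 + B2) + 1))) as Hl.
  pose proof (Rmin_r 1 (e / (2 * (B1 + B2) + 1))) as Hr. fold t in Hl, Hr.
  eapply Rle_trans; [apply (Hb t); lra|].
  apply Rle_trans with ((2 * (B1 + B2) + 1) * (e / (2 * (B1 + B2) + 1))).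
  - apply Rmult_le_compat; lra.
  - right. field. lra.
Qed.

Hypothesis Hpoly : forall k, is_poly (a k).

(** A zero is propagated twice: first down in $w$, which kills the lowest coefficient $a_k$ at $z$,
    then down in $z$, which makes $a_k$ identically zero against the choice of $k$. *)
Lemma limit_fpol_stable n :
  (exists z w, fpol n (fun k => a k z) w <> 0%C) ->
  forall z w, 0 < Im z -> 0 < Im w -> fpol n (fun k => a k z) w <> 0%C.
Proof.
  intros (z1 & w1 & H1) [x y] [u v] Hz Hw E. simpl in Hz, Hw.
  assert (Hk : exists k, (k <= n)%nat /\ exists z, a k z <> 0%C).
  { apply NNPP. intros Hno. apply H1. apply csum_zero. intros k Hk.
    replace (a k z1) with (RtoC 0); [cring|].
    symmetry. apply NNPP. intros Hne. apply Hno. exists k; split; auto. now exists z1. }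
  destruct Hk as (k1 & Hk1 & Hk1z).
  destruct (least_nat (fun k => exists z, a k z <> 0%C) k1 Hk1z) as (k & Hk & (z2 & Hz2) & Hlow).
  assert (Hzero : a k (x, y) = 0%C).
  (* Monotonicity forces zeros at all $u+iv'$ with $0<v'\le v$, hence everywhere in $w$; the
     coefficient $(n)_ka_k$ vanishes, and $(n)_k\ne0$ as $k\le n$. *)
  { assert (Hall : forall w, fpol n (fun k => a k (x, y)) w = 0%C).
    { apply is_poly_vertical_zero with (x := u) (y0 := v); [apply is_poly_pol | exact Hw |].
      intros v' Hv'. apply Cmod_eq_0, Rle_antisym; [|apply Cmod_ge_0].
      eapply Rle_trans; [apply (limit_fpol_mono n (x, y) u v v'); auto|].
      rewrite E, Cmod_0. lra. }
    pose proof (pol_zero_coef _ _ Hall k ltac:(lia)) as Hc. simpl in Hc.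
    apply NNPP. intros Hne. revert Hc. apply Cmult_neq_0; [|exact Hne].
    intros Hc. apply RtoC_inj in Hc. apply (falling_neq0 n k ltac:(lia)), INR_eq, Hc. }
  apply Hz2.
  apply (is_poly_vertical_zero (a k) x y (Hpoly k) Hz).
  intros y' Hy'. apply (limit_lowest_coef k x y y'); auto.
  intros j z Hj. apply NNPP. intros Hne. apply (Hlow j Hj). now exists z.
Qed.

End Limit.

Lemma in_H2_fpol (d : nat -> nat) (P : nat -> nat -> C) n :
  (forall k i, (d k < i)%nat -> P k i = 0%C) ->
  (exists z w, trunc_poly d P n z w <> 0%C) ->
  (forall z w, 0 < Im z -> 0 < Im w -> trunc_poly d P n z w <> 0%C) ->
  in_H2 (trunc_poly d P n).
Proof.
  intros Hd (z1 & w1 & H1) Hs.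
  (* A common degree bound for the first coefficients turns them into a square array. *)
  assert (HD : exists D, forall k, (k <= n)%nat -> (d k <= D)%nat).
  { clear. induction n as [|n (D & HD)].
    - exists (d 0%nat). intros k Hk. now replace k with 0%nat by lia.
    - exists (D + d (S n))%nat. intros k Hk. destruct (Nat.eq_dec k (S n)) as [->|]; [lia|].
      specialize (HD k ltac:(lia)). lia. }
  destruct HD as [D HD]. set (N := (n + D)%nat).
  set (c := fun i j => (RtoC (INR (Defs.falling n j)) * P j i)%C).
  assert (E : forall z w, trunc_poly d P n z w = poly2_eval N c z w).
  { intros z w. rewrite poly2_eval_pol.
    transitivity (fpol n (fun j => poly1_eval (d j) (P j) z) w); [reflexivity|].
    rewrite <- (fpol_extend n _ N) by (unfold N; lia).
    apply csum_ext. intros j _. apply (f_equal (fun x => x * Cpow w j)%C).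
    destruct (Compare_dec.le_gt_dec j n) as [Hj|Hj].
    - specialize (HD j Hj). change (poly1_eval (d j) (P j) z) with (pol (P j) (d j) z).
      rewrite <- (pol_extend (P j) (d j) N) by (auto; unfold N; lia).
      unfold pol. rewrite <- csum_mult_l. apply csum_ext. intros i _. unfold c. cring.
    - rewrite falling_gt by lia. symmetry. unfold pol. rewrite csum_zero; [simpl; cring|].
      intros i _. unfold c. rewrite falling_gt by lia. simpl. cring. }
  exists N, c. repeat split; auto.
  - intros i j Hij. unfold c. destruct (Compare_dec.le_gt_dec j n) as [Hj|Hj].
    + rewrite Hd; [ring|]. specialize (HD j Hj). unfold N in Hij. lia.
    + rewrite falling_gt by lia. simpl. ring.
  - apply NNPP. intros Hno. apply H1. rewrite E. apply csum_zero. intros i _.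
    apply csum_zero. intros j _.
    replace (c i j) with (RtoC 0); [cring|].
    symmetry. apply NNPP. intros Hne. apply Hno. now exists i, j.
Qed.

Lemma H2bar_trunc_poly (d : nat -> nat) (P : nat -> nat -> C) n :
  (forall k i, (d k < i)%nat -> P k i = 0%C) -> in_H2bar_series d P ->
  in_H2 (trunc_poly d P n) \/ (forall z w : C, trunc_poly d P n z w = 0%C).
Proof.
  intros Hd (f & Hf & Q & HQ & Hlim).
  destruct (classic (forall z w : C, trunc_poly d P n z w = 0%C)) as [H|H]; [now right|left].
  assert (Hne : exists z w, trunc_poly d P n z w <> 0%C).
  { apply NNPP. intros Hno. apply H. intros z w. apply NNPP. intros Hne. apply Hno.
    now exists z, w. }
  apply in_H2_fpol; auto. intros z w.
  apply (limit_fpol_stable f (fun k => poly1_eval (d k) (P k)) Q Hf HQ Hlim); auto.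
  intros k. apply is_poly_pol.
Qed.

(** * Szasz' inequality *)

Definition sumsq (l : list C) : R := fold_right (fun b acc => Cmod b ^ 2 + acc) 0 l.

Lemma Cmod_sq (z : C) : Cmod z ^ 2 = Re z ^ 2 + Im z ^ 2.
Proof.
  unfold Cmod. rewrite <- Rsqr_pow2, Rsqr_sqrt; [reflexivity|].
  apply Rplus_le_le_0_compat; apply pow2_ge_0.
Qed.

(** Each factor satisfies $|1+bw|^2=1+2\Re(bw)+|bw|^2\le\exp(2\Re(bw)+|bw|^2)$. *)
Lemma one_prod_exp_bound w l :
  Cmod (one_prod w l) ^ 2 <= exp (2 * Re (w * esym1 l)%C + Cmod w ^ 2 * sumsq l).
Proof.
  induction l as [|b l IH].
  - simpl one_prod; simpl esym1; simpl sumsq. rewrite Cmod_1. replace (2 * Re (w * 0)%C + Cmod w ^ 2 * 0) with 0.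
    + rewrite exp_0. lra.
    + destruct w; simpl; ring.
  - change (one_prod w (b :: l)) with ((1 + b * w) * one_prod w l)%C.
    change (sumsq (b :: l)) with (Cmod b ^ 2 + sumsq l).
    change (esym1 (b :: l)) with (b + esym1 l)%C.
    rewrite Cmod_mult, Rpow_mult_distr.
    replace (2 * Re (w * (b + esym1 l))%C + Cmod w ^ 2 * (Cmod b ^ 2 + sumsq l))
      with ((2 * Re (w * b)%C + Cmod w ^ 2 * Cmod b ^ 2)
            + (2 * Re (w * esym1 l)%C + Cmod w ^ 2 * sumsq l)).
    2:{ destruct w, b, (esym1 l); simpl; ring. }
    rewrite exp_plus. apply Rmult_le_compat; try apply pow2_ge_0; [|exact IH].
    eapply Rle_trans; [|apply exp_ineq1_le].
    rewrite !Cmod_sq. destruct w, b; simpl. right. ring.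
Qed.

(* sum |b|^2 = Re (e1^2 - 2 e2) + 2 sum (Im b)^2, and sum (Im b)^2 <= (Im e1)^2
   because the imaginary parts have the same sign. *)
Lemma sumsq_bound l : List.Forall (fun b => Im b <= 0) l ->
  sumsq l <= Cmod (esym1 l) ^ 2 + 2 * Cmod (esym2 l).
Proof.
  intros H.
  assert (K : Im (esym1 l) <= 0 /\
    sumsq l <= Re (esym1 l) ^ 2 + Im (esym1 l) ^ 2 - 2 * Re (esym2 l)).
  { induction H as [|[s t] l Ht Hl [IH1 IH2]]; [simpl; lra|].
    change (sumsq ((s, t) :: l)) with (Cmod (s, t) ^ 2 + sumsq l).
    rewrite Cmod_sq. simpl in *.
    destruct (esym1 l) as [X Y], (esym2 l) as [U V]; simpl in *. split; [lra|nra]. }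
  rewrite Cmod_sq. destruct K as [_ K].
  pose proof (Rmax_Cmod (esym2 l)) as HR. pose proof (Rmax_l (Rabs (fst (esym2 l))) (Rabs (snd (esym2 l)))).
  pose proof (Rle_abs (- Re (esym2 l))) as HA. rewrite Rabs_Ropp in HA. unfold Re in *. lra.
Qed.

(** In the factored form $e_1=q_1/q_0$ and $e_2=q_2/q_0$, so [K1] and [K2] control both sums in the
    exponent. The bound does not depend on the degree. *)
Lemma stable_bound (q : nat -> C) N w K1 K2 : (2 <= N)%nat ->
  upper_stable (pol q N) -> q 0%nat <> 0%C ->
  Cmod (q 1%nat) <= K1 * Cmod (q 0%nat) -> Cmod (q 2%nat) <= K2 * Cmod (q 0%nat) ->
  Cmod (pol q N w) ^ 2
    <= Cmod (q 0%nat) ^ 2 * exp (2 * (Cmod w * K1) + Cmod w ^ 2 * (K1 ^ 2 + 2 * K2)).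
Proof.
  intros HN Hs H0 H1 H2.
  destruct (stable_one_prod q N HN H0 Hs) as (l & [Hl E1 E2 E]).
  unfold pol. rewrite E, Cmod_mult, Rpow_mult_distr.
  apply Rmult_le_compat_l; [apply pow2_ge_0|].
  assert (Hq : 0 < Cmod (q 0%nat)) by now apply Cmod_gt_0.
  rewrite E1, Cmod_mult in H1. rewrite E2, Cmod_mult in H2.
  assert (F1 : Cmod (esym1 l) <= K1) by (apply Rmult_le_reg_l with (Cmod (q 0%nat)); lra).
  assert (F2 : Cmod (esym2 l) <= K2) by (apply Rmult_le_reg_l with (Cmod (q 0%nat)); lra).
  eapply Rle_trans; [apply one_prod_exp_bound|].
  assert (HR : Re (w * esym1 l)%C <= Cmod w * K1).
  { apply Rle_trans with (Cmod (w * esym1 l)).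
    - eapply Rle_trans; [apply Rle_abs|].
      eapply Rle_trans; [|apply Rmax_Cmod]. apply Rmax_l.
    - rewrite Cmod_mult. apply Rmult_le_compat_l; [apply Cmod_ge_0 | exact F1]. }
  assert (HS : sumsq l <= K1 ^ 2 + 2 * K2).
  { pose proof (sumsq_bound l Hl). pose proof (Cmod_ge_0 (esym1 l)). nra. }
  assert (HM : Cmod w ^ 2 * sumsq l <= Cmod w ^ 2 * (K1 ^ 2 + 2 * K2)).
  { apply Rmult_le_compat_l; [apply pow2_ge_0 | exact HS]. }
  match goal with |- exp ?x <= exp ?y => assert (Hxy : x <= y) by lra end.
  destruct Hxy as [Hxy|Hxy]; [left; now apply exp_increasing | right; now rewrite Hxy].
Qed.

Lemma pol_bounded (c : nat -> C) N r : exists U, 0 <= U /\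
  forall z, Cmod z <= r -> Cmod (pol c N z) <= U.
Proof.
  exists (Rabs (sum_n (fun k => Cmod (c k) * r ^ k) N)). split; [apply Rabs_pos|].
  intros z Hz. eapply Rle_trans; [|apply Rle_abs].
  eapply Rle_trans; [apply Cmod_csum|]. apply rsum_le. intros k _.
  rewrite Cmod_mult, Cmod_pow. apply Rmult_le_compat_l; [apply Cmod_ge_0|].
  apply pow_incr. split; [apply Cmod_ge_0 | exact Hz].
Qed.

(** Every root has $\Im b\le0$, so $|z-b|\ge\Im(z-b)\ge1$ and the leading coefficient alone gives
    the bound. *)
Lemma upper_stable_lower_bound g : is_poly g -> upper_stable g ->
  exists m, 0 < m /\ forall z, 1 <= Im z -> m <= Cmod (g z).
Proof.
  intros Hp Hs. destruct (upper_stable_factor g Hp Hs) as (a & l & Ha & Hl & H).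
  exists (Cmod a). split; [now apply Cmod_gt_0|].
  intros z Hz. rewrite H, Cmod_mult. rewrite <- (Rmult_1_r (Cmod a)) at 1.
  apply Rmult_le_compat_l; [apply Cmod_ge_0|]. clear H.
  induction Hl as [|b l Hb Hl IH]; simpl.
  - rewrite Cmod_1. lra.
  - rewrite Cmod_mult. rewrite <- (Rmult_1_r 1).
    apply Rmult_le_compat; try lra.
    pose proof (Rmax_Cmod (z - b)%C) as HR.
    pose proof (Rmax_r (Rabs (fst (z - b)%C)) (Rabs (snd (z - b)%C))).
    pose proof (Rle_abs (snd (z - b)%C)).
    destruct z, b; simpl in *. lra.
Qed.

Lemma pol_shift (c : nat -> C) k N w : (forall j, (j < k)%nat -> c j = 0%C) ->
  pol c (k + N) w = (Cpow w k * pol (fun j => c (k + j)%nat) N w)%C.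
Proof.
  intros Hc. unfold pol. rewrite <- csum_mult_l. induction N as [|N IH].
  - rewrite csum_O, Nat.add_0_r, (csum_single _ k k); [simpl; cring | lia |].
    intros j Hj Hjk. rewrite Hc by lia. ring.
  - rewrite Nat.add_succ_r, !csum_S, IH, <- Nat.add_succ_r, Cpow_add_r. cring.
Qed.

(** The coefficient multiplier after $w\mapsto w/n$: for $n>0$ it is $\prod_{j<k}(1-j/n)$, which
    decreases in $k$ and tends to $1$ as $n\to\infty$. *)
Definition lam (n k : nat) : R := INR (Defs.falling n k) * (/ INR n) ^ k.

Lemma lam_S n k : (0 < n)%nat -> lam n (S k) = lam n k * (INR (n - k) / INR n).
Proof. intros Hn. unfold lam. simpl Defs.falling. rewrite mult_INR. simpl. unfold Rdiv. ring. Qed.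

Lemma ratio_bounds n k : (0 < n)%nat -> 1 - INR k / INR n <= INR (n - k) / INR n <= 1.
Proof.
  intros Hn. assert (H : 0 < INR n) by now apply lt_0_INR.
  assert (Hk : INR n - INR k <= INR (n - k) <= INR n).
  { split; [|apply le_INR; lia].
    assert (H' : INR n <= INR (n - k + k)) by (apply le_INR; lia).
    rewrite plus_INR in H'. lra. }
  split; (apply Rmult_le_reg_r with (INR n); [exact H|]); field_simplify; lra.
Qed.

Lemma lam_bounds n k : (0 < n)%nat -> 0 <= lam n k <= 1.
Proof.
  intros Hn. assert (H : 0 < / INR n) by now apply Rinv_0_lt_compat, lt_0_INR.
  split.
  - apply Rmult_le_pos; [apply pos_INR | apply pow_le; lra].
  - induction k as [|k IH]; [unfold lam; simpl; lra|].
    rewrite lam_S by auto.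
    assert (0 <= lam n k) by (apply Rmult_le_pos; [apply pos_INR | apply pow_le; lra]).
    pose proof (ratio_bounds n k Hn).
    assert (0 <= INR (n - k) / INR n) by (apply Rmult_le_pos; [apply pos_INR | lra]).
    nra.
Qed.

Lemma lam_decr n k : (0 < n)%nat -> lam n (S k) <= lam n k.
Proof.
  intros Hn. rewrite lam_S by auto. pose proof (lam_bounds n k Hn).
  pose proof (ratio_bounds n k Hn). nra.
Qed.

(** Passing from $k$ to $k+1$ loses at most $k/n$, and these losses add up to at most $k^2/n$. *)
Lemma lam_lower n k : (0 < n)%nat -> 1 - INR k ^ 2 / INR n <= lam n k.
Proof.
  intros Hn. assert (H : 0 < INR n) by now apply lt_0_INR.
  induction k as [|k IH]; [unfold lam; simpl; lra|].
  rewrite lam_S by auto. pose proof (lam_bounds n k Hn). pose proof (ratio_bounds n k Hn).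
  apply Rle_trans with (lam n k - INR k / INR n).
  - apply Rle_trans with (1 - INR k ^ 2 / INR n - INR k / INR n); [|lra].
    rewrite S_INR. pose proof (pos_INR k). apply Rmult_le_reg_r with (INR n); auto.
    field_simplify; [|lra|lra]. nra.
  - nra.
Qed.

Lemma lam_neq0 n k : (0 < n)%nat -> (k <= n)%nat -> lam n k <> 0.
Proof.
  intros Hn Hk. apply Rmult_integral_contrapositive_currified.
  - apply not_0_INR. now apply falling_neq0.
  - apply pow_nonzero, Rinv_neq_0_compat, not_0_INR. lia.
Qed.

Lemma in_H2_scale g s : in_H2 g -> 0 < s -> in_H2 (fun z w => g z (RtoC s * w)%C).
Proof.
  intros (N & c & Hb & (i & j & Hij) & Hg & Hs) Hpos.
  exists N, (fun i j => c i j * Cpow (RtoC s) j)%C. repeat split.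
  - intros i' j' H. rewrite Hb by auto. ring.
  - exists i, j. apply Cmult_neq_0; auto. rewrite <- RtoC_pow.
    intros E. apply RtoC_inj in E. revert E. apply pow_nonzero. lra.
  - intros z w. rewrite Hg. apply csum_ext. intros i' _. apply csum_ext. intros j' _.
    rewrite Cpow_mult_l. cring.
  - intros z w Hz Hw. apply Hs; auto. destruct w; simpl in *. nra.
Qed.

Lemma in_H2_const (a : C) : a <> 0%C -> in_H2 (fun _ _ => a).
Proof.
  intros Ha. exists 0%nat, (fun i j => match i, j with O, O => a | _, _ => 0%C end).
  repeat split; auto.
  - intros [|i] [|j] [H|H]; try reflexivity; lia.
  - now exists 0%nat, 0%nat.
  - intros z w. unfold poly2_eval. rewrite !csum_O. simpl. cring.
Qed.

Lemma Cmod_imag t : Cmod (0, t) = Rabs t.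
Proof.
  unfold Cmod. simpl. replace (0 * (0 * 1) + t * (t * 1)) with (t²) by (unfold Rsqr; ring).
  apply sqrt_Rsqr_abs.
Qed.

(* The diagonal line through (z, w) enters the product of upper half-planes,
   so a bound deep inside it controls the whole polydisc. *)
Lemma in_H2_push_up g z w r : in_H2 g -> 0 < r -> Cmod z <= r -> Cmod w <= r ->
  exists z' w', Cmod z' <= 3 * r + 1 /\ Cmod w' <= 3 * r + 1 /\ 1 <= Im z' /\ 1 <= Im w' /\
    Cmod (g z w) <= Cmod (g z' w').
Proof.
  intros Hg Hr Hz Hw. destruct z as [x y], w as [u v].
  set (mu := Rmin y v).
  assert (Hy : Rabs y <= r).
  { eapply Rle_trans; [|exact Hz]. eapply Rle_trans; [|apply Rmax_Cmod]. apply Rmax_r. }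
  assert (Hv : Rabs v <= r).
  { eapply Rle_trans; [|exact Hw]. eapply Rle_trans; [|apply Rmax_Cmod]. apply Rmax_r. }
  apply Rabs_le_between in Hy. apply Rabs_le_between in Hv.
  (* Lowering both points by the smaller imaginary part leaves [z0] and [w0] in the closed upper
     half-planes, so the restriction [F] to the diagonal line is stable. *)
  assert (Hmu : - r <= mu <= r /\ mu <= y /\ mu <= v).
  { unfold mu, Rmin. destruct (Rle_dec y v); lra. }
  set (z0 := (x, y - mu) : C). set (w0 := (u, v - mu) : C). set (up := (0, r + 1) : C).
  set (F := fun t : C => g (z0 + t)%C (w0 + t)%C).
  assert (HF : Cmod (F (0, mu)) <= Cmod (F up)).
  { apply upper_stable_mono; [| |lra].
    - apply (in_H2_is_poly g (fun t => z0 + t)%C (fun t => w0 + t)%C Hg);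
        apply is_poly_plus; try apply is_poly_id; apply is_poly_const.
    - intros [t1 t2] Ht. simpl in Ht. apply in_H2_nonzero; auto; simpl; lra. }
  assert (Hup : forall a b : R, Cmod (a, b) <= r ->
            Cmod (Cplus (a, b - mu) up) <= 3 * r + 1).
  { intros a b Hab.
    replace (Cplus (a, b - mu) up) with (Cplus (a, b) (0, r + 1 - mu))
      by (unfold Cplus, up; simpl; f_equal; ring).
    eapply Rle_trans; [apply Cmod_triangle|]. rewrite Cmod_imag, Rabs_pos_eq by lra. lra. }
  exists (z0 + up)%C, (w0 + up)%C.
  repeat split; try (apply Hup; assumption); try (simpl; lra).
  replace (g (x, y) (u, v)) with (F (0, mu)); [exact HF|].
  unfold F, z0, w0, Cplus. simpl. f_equal; f_equal; ring.
Qed.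

(** * Convergence of the rescaled polynomials *)

Section Converse.

Variables (p : nat -> C -> C) (k0 : nat).
Hypothesis Hpoly : forall k, exists (c : nat -> C) N, forall z, p k z = pol c N z.
Hypothesis Hlow : forall k z, (k < k0)%nat -> p k z = 0%C.
Hypothesis Hst : upper_stable (p k0).

Definition scaled (n : nat) (z w : C) : C := pol (fun k => RtoC (lam n k) * p k z)%C n w.

Hypothesis HG : forall n, (0 < n)%nat -> (k0 <= n)%nat -> in_H2 (scaled n).

Lemma scaled_bounded r : 0 < r -> exists B, 0 <= B /\
  forall n z w, (0 < n)%nat -> (k0 <= n)%nat -> Cmod z <= r -> Cmod w <= r ->
    Cmod (scaled n z w) <= B.
Proof.
  intros Hr. set (R1 := 3 * r + 1).
  assert (HU : forall k, exists U, 0 <= U /\ forall z, Cmod z <= R1 -> Cmod (p k z) <= U).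
  { intros k. destruct (Hpoly k) as (c & N & Hc).
    destruct (pol_bounded c N R1) as (U & HU0 & HU). exists U. split; auto.
    intros z Hz. rewrite Hc. auto. }
  destruct (HU k0) as (U0 & HU0 & Hb0). destruct (HU (k0 + 1)%nat) as (U1 & HU1 & Hb1).
  destruct (HU (k0 + 2)%nat) as (U2 & HU2 & Hb2).
  assert (Hp0 : is_poly (p k0)).
  { destruct (Hpoly k0) as (c & N & Hc). apply is_poly_ext with (f := pol c N); auto.
    apply is_poly_pol. }
  destruct (upper_stable_lower_bound (p k0) Hp0 Hst) as (m & Hm & Hlb).
  (* On $\Im z\ge1$ these bound the ratios of [p (k0 + 1)] and [p (k0 + 2)] to [p k0]. As [lam n k]
     decreases in [k], they serve the rescaled coefficients for every [n]. *)
  set (K1 := U1 / m). set (K2 := U2 / m).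
  assert (HK1 : 0 <= K1) by (apply Rmult_le_pos; [lra | left; now apply Rinv_0_lt_compat]).
  assert (HK2 : 0 <= K2) by (apply Rmult_le_pos; [lra | left; now apply Rinv_0_lt_compat]).
  set (B2 := (R1 ^ k0) ^ 2 * (U0 ^ 2 * exp (2 * (R1 * K1) + R1 ^ 2 * (K1 ^ 2 + 2 * K2)))).
  assert (HR1 : 0 < R1) by (unfold R1; lra).
  assert (HB2 : 0 <= B2).
  { apply Rmult_le_pos; [apply pow2_ge_0|].
    apply Rmult_le_pos; [apply pow2_ge_0 | left; apply exp_pos]. }
  (* [B2] bounds the squared modulus, and $x^2\le B_2$ implies $x\le B_2+1$. *)
  exists (B2 + 1). split; [lra|]. intros n z w Hn Hk Hz Hw.
  destruct (in_H2_push_up (scaled n) z w r (HG n Hn Hk) Hr Hz Hw)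
    as (z' & w' & Hz' & Hw' & Hiz & Hiw & Hle). fold R1 in Hz', Hw'.
  eapply Rle_trans; [exact Hle|].
  set (q := fun j => (RtoC (lam n (k0 + j)) * p (k0 + j) z')%C).
  (* Padding by zero coefficients up to degree $n+2$ after the shift meets the condition [2 <= N] of
     [stable_bound]. *)
  assert (E : forall t, scaled n z' t = (Cpow t k0 * pol q (n + 2) t)%C).
  { intros t. unfold scaled.
    rewrite <- (pol_extend (fun k => RtoC (lam n k) * p k z')%C n (k0 + (n + 2))%nat).
    - apply (pol_shift (fun k => RtoC (lam n k) * p k z')%C).
      intros j Hj. rewrite Hlow by auto. ring.
    - lia.
    - intros k Hkn. unfold lam. rewrite falling_gt by auto. simpl. rewrite Rmult_0_l. ring. }
  assert (Hq0 : Cmod (q 0%nat) <= U0).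
  { unfold q. rewrite Nat.add_0_r, Cmod_mult, Cmod_R.
    pose proof (lam_bounds n k0 Hn). rewrite Rabs_pos_eq by lra.
    pose proof (Hb0 z' Hz'). pose proof (Cmod_ge_0 (p k0 z')). nra. }
  assert (Hratio : forall j U, 0 <= U -> Cmod (p (k0 + j)%nat z') <= U ->
            lam n (k0 + j) <= lam n k0 -> Cmod (q j) <= U / m * Cmod (q 0%nat)).
  { intros j U HU' Hb Hl. unfold q. rewrite Nat.add_0_r, !Cmod_mult, !Cmod_R.
    pose proof (lam_bounds n k0 Hn). pose proof (lam_bounds n (k0 + j) Hn).
    rewrite !Rabs_pos_eq by lra.
    assert (Hle' : U <= U / m * Cmod (p k0 z')).
    { replace U with (U / m * m) at 1 by (field; lra). apply Rmult_le_compat_l; auto.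
      apply Rmult_le_pos; [lra | left; now apply Rinv_0_lt_compat]. }
    apply Rle_trans with (lam n k0 * U).
    - apply Rmult_le_compat; try lra. apply Cmod_ge_0.
    - replace (U / m * (lam n k0 * Cmod (p k0 z'))) with (lam n k0 * (U / m * Cmod (p k0 z'))) by ring.
      apply Rmult_le_compat_l; lra. }
  assert (Hbound : Cmod (pol q (n + 2) w') ^ 2
     <= Cmod (q 0%nat) ^ 2 * exp (2 * (Cmod w' * K1) + Cmod w' ^ 2 * (K1 ^ 2 + 2 * K2))).
  { apply stable_bound; [lia | | | |].
    - intros t Ht Hzero. apply (in_H2_nonzero (scaled n) z' t (HG n Hn Hk)); auto; [lra|].
      rewrite E, Hzero. ring.
    - unfold q. rewrite Nat.add_0_r. apply Cmult_neq_0.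
      + intros H0. apply RtoC_inj in H0. now apply (lam_neq0 n k0 Hn Hk).
      + apply Hst. lra.
    - apply Hratio; auto. rewrite Nat.add_1_r. now apply lam_decr.
    - apply Hratio; auto. replace (k0 + 2)%nat with (S (S k0)) by lia.
      eapply Rle_trans; apply lam_decr; auto. }
  pose proof (Cmod_ge_0 w') as Hw0.
  assert (Hexp : exp (2 * (Cmod w' * K1) + Cmod w' ^ 2 * (K1 ^ 2 + 2 * K2))
                 <= exp (2 * (R1 * K1) + R1 ^ 2 * (K1 ^ 2 + 2 * K2))).
  { assert (H1 : Cmod w' * K1 <= R1 * K1) by (apply Rmult_le_compat_r; lra).
    assert (H2 : Cmod w' ^ 2 * (K1 ^ 2 + 2 * K2) <= R1 ^ 2 * (K1 ^ 2 + 2 * K2)).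
    { apply Rmult_le_compat_r; [pose proof (pow2_ge_0 K1); lra|]. apply pow_incr. lra. }
    match goal with |- exp ?x <= exp ?y => assert (Hxy : x <= y) by lra end.
    destruct Hxy as [Hxy|Hxy]; [left; now apply exp_increasing | right; now rewrite Hxy]. }
  assert (Hsq : Cmod (scaled n z' w') ^ 2 <= B2).
  { rewrite E, Cmod_mult, Cmod_pow, Rpow_mult_distr. unfold B2.
    apply Rmult_le_compat; try apply pow2_ge_0.
    - apply pow_incr. split; [now apply pow_le|]. apply pow_incr. lra.
    - eapply Rle_trans; [exact Hbound|].
      apply Rmult_le_compat; try apply pow2_ge_0; [left; apply exp_pos | | exact Hexp].
      apply pow_incr. split; [apply Cmod_ge_0 | exact Hq0]. }
  pose proof (Cmod_ge_0 (scaled n z' w')). nra.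
Qed.

Lemma archimedean_ratio K e : 0 < e -> exists n0, (0 < n0)%nat /\
  forall n, (n0 <= n)%nat -> K / INR n < e.
Proof.
  intros He. destruct (INR_unbounded (Rabs K / e)) as [n0 Hn0].
  exists (S n0). split; [lia|]. intros n Hn.
  assert (H1 : INR n0 <= INR n) by (apply le_INR; lia).
  assert (H2 : 0 < INR n) by (apply lt_0_INR; lia).
  apply Rmult_lt_reg_r with (INR n); auto.
  replace (K / INR n * INR n) with K by (field; lra).
  apply Rle_lt_trans with (Rabs K); [apply Rle_abs|].
  replace (Rabs K) with (e * (Rabs K / e)) by (field; lra).
  apply Rmult_lt_compat_l; lra.
Qed.

(** Cauchy's estimate in $w$ bounds [lam n k] times the coefficient uniformly in $n$; for $n$ large
    in terms of $k$ this multiplier is at least $1/2$, hence the factor $2$. *)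
Lemma coef_growth r : 0 < r -> exists B, 0 <= B /\
  forall k z, Cmod z <= r -> Cmod (p k z) * r ^ k <= B.
Proof.
  intros Hr. destruct (scaled_bounded r Hr) as (B & HB0 & HB).
  exists (2 * B). split; [lra|]. intros k z Hz.
  destruct (archimedean_ratio (INR k ^ 2) (1 / 2) ltac:(lra)) as (n0 & Hn0 & Hn0').
  set (n := (n0 + k + k0)%nat).
  assert (Hn : (0 < n)%nat) by lia.
  assert (Hc := cauchy_estimate (fun k => RtoC (lam n k) * p k z)%C n r B k ltac:(lra) ltac:(lia)).
  cbv beta in Hc. rewrite Cmod_mult, Cmod_R in Hc. pose proof (lam_bounds n k Hn) as Hl.
  rewrite Rabs_pos_eq in Hc by lra.
  assert (Hc' : lam n k * Cmod (p k z) * r ^ k <= B).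
  { apply Hc. intros w Hw. apply (HB n z w); auto; [lia | lra]. }
  pose proof (lam_lower n k Hn). specialize (Hn0' n ltac:(lia)).
  assert (0 <= Cmod (p k z) * r ^ k).
  { apply Rmult_le_pos; [apply Cmod_ge_0 | apply pow_le; lra]. }
  nra.
Qed.

Lemma series_converges z w : exists l : C, is_series (fun k => p k z * Cpow w k)%C l.
Proof.
  pose proof (Cmod_ge_0 z). pose proof (Cmod_ge_0 w).
  (* As $r\ge2|w|$, the terms are dominated by $B\,2^{-k}$. *)
  set (r := Cmod z + 2 * Cmod w + 1). assert (Hr : 0 < r) by (unfold r; lra).
  destruct (coef_growth r Hr) as (B & HB0 & HB).
  apply (ex_series_le (K := C_AbsRing) (V := C_CompleteNormedModule) _
           (fun k => scal B ((1 / 2) ^ k))).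
  - intros k. change (Cmod (p k z * Cpow w k) <= B * (1 / 2) ^ k).
    rewrite Cmod_mult, Cmod_pow.
    apply Rle_trans with (Cmod (p k z) * (r ^ k * (1 / 2) ^ k)).
    + apply Rmult_le_compat_l; [apply Cmod_ge_0|]. rewrite <- Rpow_mult_distr.
      apply pow_incr. unfold r. lra.
    + rewrite <- Rmult_assoc. apply Rmult_le_compat_r; [apply pow_le; lra|].
      apply HB. unfold r. lra.
  - apply @ex_series_scal, ex_series_geom. rewrite Rabs_pos_eq; lra.
Qed.

(** Both series are cut at degree [L]. On the doubled radius the two tails are geometrically small,
    uniformly in $n$, and the heads agree in the limit because [lam n k] tends to $1$. The shift by
    [S k0] makes every index positive and at least [k0]. *)
Lemma scaled_converges (f : C -> C -> C) :
  (forall z w, is_series (fun k => p k z * Cpow w k)%C (f z w)) ->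
  cvg_compact (fun m => scaled (m + S k0)) f.
Proof.
  intros Hf r eps Hr He.
  destruct (coef_growth (2 * r) ltac:(lra)) as (B & HB0 & HB).
  destruct (pow_half_small (eps / 3) (2 * B) ltac:(lra)) as [L HL].
  specialize (HL (S L) ltac:(lia)).
  (* The heads have $L+1$ terms, each differing by at most $(L^2/n)B$. *)
  destruct (archimedean_ratio (INR (S L) * (INR L ^ 2 * B)) (eps / 3) ltac:(lra)) as (n0 & Hn0 & Hlarge).
  exists (n0 + L)%nat. intros m Hm z w Hz Hw.
  set (n := (m + S k0)%nat). assert (Hn : (0 < n)%nat) by lia.
  specialize (Hlarge n ltac:(lia)).
  set (a := fun k => p k z). set (b := fun k => (RtoC (lam n k) * p k z)%C).
  assert (Ha : forall k, Cmod (a k) * (2 * r) ^ k <= B) by (intros k; apply HB; lra).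
  assert (Hb : forall k, Cmod (b k) * (2 * r) ^ k <= B).
  { intros k. unfold b. rewrite Cmod_mult, Cmod_R. pose proof (lam_bounds n k Hn).
    rewrite Rabs_pos_eq by lra. specialize (Ha k). unfold a in Ha.
    assert (0 <= Cmod (p k z) * (2 * r) ^ k).
    { apply Rmult_le_pos; [apply Cmod_ge_0 | apply pow_le; lra]. }
    nra. }
  assert (Hx : 0 <= Cmod w / (2 * r) <= 1 / 2).
  { pose proof (Cmod_ge_0 w). split.
    - apply Rmult_le_pos; [lra | left; apply Rinv_0_lt_compat; lra].
    - apply Rmult_le_reg_r with (2 * r); [lra|]. field_simplify; lra. }
  assert (Hpow : (Cmod w / (2 * r)) ^ S L <= (1 / 2) ^ S L) by (apply pow_incr; exact Hx).
  assert (T1 : Cmod (f z w - pol a L w) < eps / 3).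
  { pose proof (series_tail a (f z w) w (2 * r) B L (Hf z w) ltac:(lra) ltac:(lra) Ha). nra. }
  assert (T2 : Cmod (pol b n w - pol b L w) < eps / 3).
  { pose proof (pol_tail b w (2 * r) B L (n - L) ltac:(lra) ltac:(lra) Hb) as T.
    replace (L + (n - L))%nat with n in T by lia.
    assert (0 <= (Cmod w / (2 * r)) ^ S n) by (apply pow_le; lra). nra. }
  assert (T3 : Cmod (pol b L w - pol a L w) < eps / 3).
  { rewrite <- pol_minus.
    eapply Rle_lt_trans; [apply Cmod_csum|].
    eapply Rle_lt_trans; [apply (rsum_le _ (fun _ => INR L ^ 2 * B / INR n))|].
    - intros k Hk. unfold b, a.
      replace ((RtoC (lam n k) * p k z - p k z) * Cpow w k)%C
        with (RtoC (lam n k - 1) * (p k z * Cpow w k))%C by (rewrite RtoC_minus; ring).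
      rewrite !Cmod_mult, Cmod_R, Cmod_pow. pose proof (lam_bounds n k Hn).
      pose proof (lam_lower n k Hn). rewrite Rabs_left1 by lra.
      assert (Hkl : INR k ^ 2 / INR n <= INR L ^ 2 / INR n).
      { apply Rmult_le_compat_r; [left; now apply Rinv_0_lt_compat, lt_0_INR|].
        apply pow_incr. split; [apply pos_INR | now apply le_INR]. }
      replace (INR L ^ 2 * B / INR n) with (INR L ^ 2 / INR n * B) by (unfold Rdiv; ring).
      apply Rmult_le_compat; try lra.
      + apply Rmult_le_pos; [apply Cmod_ge_0 | apply pow_le, Cmod_ge_0].
      + apply Rle_trans with (2 := Ha k). apply Rmult_le_compat_l; [apply Cmod_ge_0|].
        apply pow_incr. split; [apply Cmod_ge_0 | lra].
    - rewrite sum_n_const. unfold Rdiv in *. lra. }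
  change (scaled n z w) with (pol b n w).
  eapply Rle_lt_trans; [apply (Cmod_minus_triangle _ (pol b L w))|].
  pose proof (Cmod_minus_triangle (pol b L w) (pol a L w) (f z w)) as Htri.
  rewrite (Cmod_minus_sym (pol a L w)) in Htri. lra.
Qed.

End Converse.

(** * From the given polynomials to the rescaled ones, and the equivalence *)

Lemma trunc_poly_scaled (d : nat -> nat) (P : nat -> nat -> C) n z w :
  trunc_poly d P n z (RtoC (/ INR n) * w)%C
    = scaled (fun k => poly1_eval (d k) (P k)) n z w.
Proof.
  apply csum_ext. intros k _. rewrite Cpow_mult_l. unfold lam.
  rewrite RtoC_mult, RtoC_pow. cring.
Qed.

Lemma in_H2_ext g h : (forall z w, g z w = h z w) -> in_H2 g -> in_H2 h.
Proof.
  intros E (N & c & Hb & Hn & Hg & Hs). exists N, c. repeat split; auto.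
  - intros z w. now rewrite <- E.
  - intros z w. rewrite <- E. apply Hs.
Qed.

(** For the zero series: the zero function is a limit of nonzero constants, although it is not
    itself in $\mathcal H_2(\mathbb C)$. *)
Lemma cvg_compact_inv_const : cvg_compact (fun m _ _ => RtoC (/ INR (S m))) (fun _ _ => 0%C).
Proof.
  intros r eps Hr He. destruct (archimedean_ratio 1 eps He) as (n0 & Hn0 & H).
  exists n0. intros m Hm z w _ _. specialize (H (S m) ltac:(lia)).
  replace (RtoC (/ INR (S m)) - 0)%C with (RtoC (/ INR (S m))) by ring.
  rewrite Cmod_R, Rabs_pos_eq; [lra|].
  left. apply Rinv_0_lt_compat, lt_0_INR. lia.
Qed.

Lemma trunc_poly_H2bar (d : nat -> nat) (P : nat -> nat -> C) :
  (forall n, in_H2 (trunc_poly d P n) \/ (forall z w : C, trunc_poly d P n z w = 0%C)) ->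
  in_H2bar_series d P.
Proof.
  intros HT. set (p := fun k => poly1_eval (d k) (P k)).
  destruct (classic (exists k z, p k z <> 0%C)) as [(k1 & Hk1)|Hzero].
  - destruct (least_nat (fun k => exists z, p k z <> 0%C) k1 Hk1) as (k0 & _ & (z1 & Hz1) & Hmin).
    assert (Hlow : forall k z, (k < k0)%nat -> p k z = 0%C).
    { intros k z Hk. apply NNPP. intros Hne. apply (Hmin k Hk). now exists z. }
    (* The alternative of vanishing is excluded by the nonzero coefficient
       $(n)_{k_0}P_{k_0}(z_1)$. *)
    assert (HH : forall n, (k0 <= n)%nat -> in_H2 (trunc_poly d P n)).
    { intros n Hn. destruct (HT n) as [H|H]; auto. exfalso.
      pose proof (pol_zero_coef (fun k => RtoC (INR (Defs.falling n k)) * p k z1)%C n (H z1) k0 Hn) as Hc.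
      revert Hc. apply Cmult_neq_0; auto. intros Hc. apply RtoC_inj in Hc.
      now apply (falling_neq0 n k0 Hn), INR_eq. }
    assert (Hst : upper_stable (p k0)).
    (* For $n=k_0$ only the term $(k_0)_{k_0}P_{k_0}(z)w^{k_0}$ is left, and it is tested at
       $w=i$. *)
    { intros z Hz Hp. apply (in_H2_nonzero _ z Ci (HH k0 (le_n _)) Hz); [simpl; lra|].
      apply csum_zero. intros k Hk. fold (p k z).
      destruct (Nat.eq_dec k k0) as [->|Hne].
      - change (poly1_eval (d k0) (P k0) z) with (p k0 z). rewrite Hp. cring.
      - change (poly1_eval (d k) (P k) z) with (p k z). rewrite Hlow by lia. cring. }
    assert (HG : forall n, (0 < n)%nat -> (k0 <= n)%nat -> in_H2 (scaled p n)).
    { intros n Hn Hk. eapply in_H2_ext; [intros z w; apply trunc_poly_scaled|].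
      apply in_H2_scale; [now apply HH|]. now apply Rinv_0_lt_compat, lt_0_INR. }
    assert (Hpoly : forall k, exists (c : nat -> C) N, forall z, p k z = pol c N z).
    { intros k. now exists (P k), (d k). }
    pose proof (series_converges p k0 Hpoly Hlow Hst HG) as Hser.
    set (f := fun z w => proj1_sig (constructive_indefinite_description _ (Hser z w))).
    assert (Hf : forall z w, is_series (fun k => p k z * Cpow w k)%C (f z w)).
    { intros z w. unfold f. apply proj2_sig. }
    exists f. split; [exact Hf|]. exists (fun m => scaled p (m + S k0)). split.
    + intros m. apply HG; lia.
    + now apply scaled_converges.
  - exists (fun _ _ => 0%C). split.
    + intros z w. apply is_series_eps. intros eps He. exists 0%nat. intros n _.
      rewrite csum_zero.
      * replace (0 - 0)%C with (RtoC 0) by ring. now rewrite Cmod_0.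
      * intros k _. replace (poly1_eval (d k) (P k) z) with (RtoC 0); [cring|].
        symmetry. apply NNPP. intros Hne. apply Hzero. now exists k, z.
    + exists (fun m _ _ => RtoC (/ INR (S m))). split; [|apply cvg_compact_inv_const].
      intros m. apply in_H2_const. intros E. apply RtoC_inj in E. revert E.
      apply Rinv_neq_0_compat, not_0_INR. lia.
Qed.

Theorem mainTheorem16 (P : nat -> nat -> C) (d : nat -> nat)
  (Hd : forall k i : nat, (d k < i)%nat -> P k i = 0%C) :
  in_H2bar_series d P <->
  (forall n : nat,
     in_H2 (trunc_poly d P n) \/ (forall z w : C, trunc_poly d P n z w = 0%C)).
Proof.
  split.
  - intros H n. now apply H2bar_trunc_poly.
  - apply trunc_poly_H2bar.
Qed.
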